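(* Let $H(x,y)=\frac{1}{2}y^2+b_1x + b_2x^2 + \cdots + b_n x^n$, where $b_n\neq0$, $n\geq2$. Let $\{\Gamma_h\mid h\in(\alpha,\beta)\}$ be a period annulus of $\dot x=H_y,\ \dot y=-H_x$ and let $\Gamma_h^+$ be the orbital arcs described in the context. Suppose that for any $h\in(\alpha,\beta)$ the orbital arc $\Gamma_h^+$ is from the point $(x_1(h),y_1(h))$ to the point $(x_2(h),y_2(h))$. Then the column vector function $\widetilde{\boldsymbol X}(h)=\mathrm{col}(I^+_{0,1}(h),I^+_{1,1}(h),\ldots,I^+_{n-2,1}(h))$ satisfies the Picard–Fuchs equations $$2(\boldsymbol T_1+\boldsymbol T_2\boldsymbol T_4^{-1}\boldsymbol T_3)\big(\widetilde{\boldsymbol X}'(h)-\boldsymbol J(h)\big)+2\boldsymbol T_2\boldsymbol T_4^{-1}\boldsymbol K(h)=\widetilde{\boldsymbol X}(h),$$ where $$\boldsymbol K(h)=\mathrm{col}(K_{0,1}(h),K_{1,1}(h),\ldots,K_{n-1,1}(h)),\qquad \boldsymbol J(h)=\mathrm{col}(J_0(h),J_1(h),\ldots,J_{n-2}(h)),$$ with $J_i(h)=x_2^i(h)y_2(h)x_2'(h)-x_1^i(h)y_1(h)x_1'(h)$, and the matrices $\boldsymbol T_1,\boldsymbol T_2,\boldsymbol T_3,\boldsymbol T_4$ are defined in the context.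
   Context: Setting: $\{\Gamma_h\mid h\in(\alpha,\beta)\}$ is a continuous family of periodic orbits $\Gamma_h\subset H^{-1}(h)$ of $\dot x=H_y,\ \dot y=-H_x$. The separation line is $L(x,y,\theta)=\sin(\theta)(x-c)-\cos(\theta)y=0$ with $0<\theta\le\pi$ and $c$ constant; it splits each $\Gamma_h$ into two nonempty connected parts $\Gamma_h^\pm=\Gamma_h\cap\Sigma^\pm$, where $\Sigma^\pm=\{\pm L(x,y,\theta)>0\}$. Arcs are oriented by the flow. Notation: $I^+_{i,j}(h)=\int_{\Gamma_h^+}x^iy^j\,\mathrm{d}x$ and $K_{i,j}(h)=\int_{\Gamma_h^+}\mathrm{d}(x^iy^j)=x_2^i(h)y_2^j(h)-x_1^i(h)y_1^j(h)$. A prime denotes the derivative with respect to $h$ (existence of $x_1',x_2'$ is implicit in the definition of $J_i$). Matrices (rows and columns indexed from $0$; $r$ is the row, $s$ the column): $\boldsymbol T_1$ is $(n-1)\times(n-1)$ with entries $h$ if $s=r$, $-b_{s-r}$ if $s>r$, and $0$ if $s<r$. $\boldsymbol T_2$ is $(n-1)\times n$ with entries $b_{n-1+s-r}$ if $s\le r+1$, and $0$ otherwise. $\boldsymbol T_3$ is $n\times(n-1)$ with entries $(r+s+1)b_{s-r+1}$ if $s\ge r$, $-2rh$ if $s=r-1$, and $0$ if $s<r-1$. $\boldsymbol T_4$ is $n\times n$ lower triangular with entries $(n+r+s)b_{n+s-r}$ if $s\le r$, and $0$ otherwise. *)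

(* Defs.v *)
From HB Require Import structures.
From mathcomp Require Import all_boot all_order all_algebra.
From mathcomp Require Import all_classical all_reals all_analysis.

Set Implicit Arguments.
Unset Strict Implicit.
Unset Printing Implicit Defensive.

Import Order.TTheory GRing.Theory Num.Theory.
Import numFieldNormedType.Exports.

Local Open Scope classical_set_scope.
Local Open Scope ring_scope.

Section Planar.
Variable R : realType.
Implicit Types (H f g : R -> R -> R) (phi : R -> R * R) (G A : set (R * R)).

Definition hamiltonian (n : nat) (b : nat -> R) (x y : R) : R :=
  2^-1 * y ^+ 2 + \sum_(1 <= k < n.+1) b k * x ^+ k.

Definition is_solution H phi : Prop :=
  forall t : R,
    is_derive t 1 (fun s => (phi s).1) (derive1 (fun y => H (phi t).1 y) (phi t).2) /\
    is_derive t 1 (fun s => (phi s).2) (- derive1 (fun x => H x (phi t).2) (phi t).1).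

(* The image of a nonconstant periodic solution; equilibria are excluded. *)
Definition periodic_orbit H G : Prop :=
  exists (phi : R -> R * R) (T : R),
    [/\ is_solution H phi, 0 < T, (forall t, phi (t + T) = phi t),
        (exists t, phi t <> phi 0) & G = range phi].

(* Continuity at h0 for the Hausdorff distance between the sets Gamma h. *)
Definition hausdorff_continuous_at (Gamma : R -> set (R * R)) (h0 : R) : Prop :=
  forall e : R, 0 < e ->
    \forall h \near h0,
      (forall p, Gamma h p -> exists2 q, Gamma h0 q & ball q e p) /\
      (forall q, Gamma h0 q -> exists2 p, Gamma h p & ball p e q).

(* The endpoints alpha, beta of the energy interval may be infinite. *)
Definition energy_interval (alpha beta : \bar R) : set R :=
  [set h | (alpha < h%:E)%E /\ (h%:E < beta)%E].

Definition period_annulus H (alpha beta : \bar R) (Gamma : R -> set (R * R)) : Prop :=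
  forall h, energy_interval alpha beta h ->
    [/\ periodic_orbit H (Gamma h),
        Gamma h `<=` [set p | H p.1 p.2 = h]
      & hausdorff_continuous_at Gamma h].

Definition sepline (theta c x y : R) : R := sin theta * (x - c) - cos theta * y.

Definition Sigma_pos (theta c : R) : set (R * R) :=
  [set p | 0 < sepline theta c p.1 p.2].

Definition Sigma_neg (theta c : R) : set (R * R) :=
  [set p | 0 < - sepline theta c p.1 p.2].

Definition splits (theta c : R) G : Prop :=
  [/\ G `&` Sigma_pos theta c !=set0, connected (G `&` Sigma_pos theta c),
      G `&` Sigma_neg theta c !=set0 & connected (G `&` Sigma_neg theta c)].

(* A is an arc without its end points, traversed once by the solution phi as
   time runs from t1 to t2, hence oriented by the flow from p1 to p2. *)
Definition orbital_arc H A (p1 p2 : R * R) phi (t1 t2 : R) : Prop :=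
  [/\ is_solution H phi, t1 < t2, {in `]t1, t2[ &, injective phi},
      phi @` `]t1, t2[ = A & phi t1 = p1 /\ phi t2 = p2].

(* The line integral of the 1-form f dg along phi restricted to [t1, t2]. *)
Definition line_integral phi (t1 t2 : R) f g : R :=
  \int[lebesgue_measure]_(t in `[t1, t2])
    (f (phi t).1 (phi t).2 * derive1 (fun s => g (phi s).1 (phi s).2) t).

Definition arcI phi (t1 t2 : R) (i j : nat) : R :=
  line_integral phi t1 t2 (fun x y => x ^+ i * y ^+ j) (fun x _ => x).

Definition arcK phi (t1 t2 : R) (i j : nat) : R :=
  line_integral phi t1 t2 (fun _ _ => 1) (fun x y => x ^+ i * y ^+ j).

End Planar.

(* In every entry below whose guard holds, the natural-number subtractions are
   not truncated and the index of b lies between 1 and n. *)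
Section Matrices.
Variables (R : realType) (n : nat) (b : nat -> R).

Definition T1 (h : R) : 'M[R]_(n.-1) :=
  \matrix_(r, s) if s == r :> nat then h
                 else if (r < s)%N then - b (s - r)%N else 0.

Definition T2 : 'M[R]_(n.-1, n) :=
  \matrix_(r, s) if (s <= r.+1)%N then b (n.-1 + s - r)%N else 0.

Definition T3 (h : R) : 'M[R]_(n, n.-1) :=
  \matrix_(r, s) if (r <= s)%N then (r + s + 1)%N%:R * b (s - r + 1)%N
                 else if s.+1 == r :> nat then - (2 * r%:R * h) else 0.

Definition T4 : 'M[R]_n :=
  \matrix_(r, s) if (s <= r)%N then (n + r + s)%N%:R * b (n + s - r)%N else 0.

End Matrices.

(* Main.v *)
From HB Require Import structures.
From mathcomp Require Import all_boot all_order all_algebra.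
From mathcomp Require Import all_classical all_reals all_analysis.
From mathcomp Require Import measurable_realfun ring lra zify.
Require Import Defs.

Set Implicit Arguments.
Unset Strict Implicit.
Unset Printing Implicit Defensive.

Import Order.TTheory GRing.Theory Num.Theory.
Import numFieldNormedType.Exports.

Local Open Scope classical_set_scope.
Local Open Scope ring_scope.

(** Write p for the potential, so that H = y^2 / 2 + p(x) and the flow is x' = y,
y' = - p'(x), and let A_i(h) be the integral of x^i dt along the arc of energy
h. The theorem rests on the formula I_i' = A_i + J_i, where I_i is the integral
of x^i y dx; what remains is linear algebra. Since y^2 = 2 (h - p(x)) on the
arc, both I_i and the increments K_i of x^i y are linear combinations of
A_0, ..., A_(2n-2) ([arcI_moments], [arcK_moments]). In matrix form these
relations are X = 2 T1 A + 2 T2 B and T4 B = T3 A + K, where B is the opposite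
of (A_(n-1), ..., A_(2n-2)), and eliminating B gives the Picard-Fuchs equations
([picard_fuchs_algebra]).

To differentiate I_i, let y = ell(x) be the separation line and split x^i y dx
into x^i (y - ell(x)) dx and the exact form x^i ell(x) dx ([arcI_action]). The
end points of the arc lie on the line ([arc_endpoints]), so the exact part has
derivative J_i ([chord_derive]). The integrand of the other part vanishes on the
line, so that the motion of the end points does not contribute to its
derivative. When the line is the vertical line x = c, ell is read as 0: the
exact part and J_i both vanish, and the end points have the fixed abscissa c.

The periodic orbit of energy h is an oval: it consists of the points
(x, r) and (x, - r) with r = sqrt (2 (h - p(x))), for x between two turning
points a and d at which p = h and p' does not vanish ([oval_of_periodic]). The
integral of x^i (y - ell(x)) dx over the arc is therefore the integral over a
fixed segment of the x-axis of a function of x and r ([arc_fold],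
[slice_Int]). Formally its derivative in h is the integral of x^i / r over those
points of the oval that lie on the positive side of the line, that is, of x^i dt
over the arc, which is A_i. The factor 1 / r is singular at the turning points.
It is absorbed by integrating with respect to the time of the oval of energy h0,
where dx = r dt and the difference quotients are bounded; the parts of nearby
ovals that stick out of [a0, d0] contribute O(|h - h0|^(3/2)). The side of the
line is locally constant except at finitely many times, and dominated
convergence concludes ([derive_under_Int], [action_derive]). *)

(** * Integrals of locally bounded functions over segments *)

Section Integrals.
Variable R : realType.
Implicit Types (f g : R -> R) (p q r : R).

(** Measurable and bounded on segments. Every integrand below has this form, which
is stable under sums, products, continuous changes of variable and case
distinctions, and entails integrability over segments; continuity would not do,
because the indicator of one side of the line enters the integrands. *)
Definition lbm f : Prop :=
  measurable_fun [set: R] f /\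
  forall p q, exists C : R, forall t, p <= t <= q -> `|f t| <= C.

Lemma lbm_continuous f : continuous f -> lbm f.
Proof.
move=> cf; split; first exact: continuous_measurable_fun.
move=> p q; have [pq|qp] := leP p q; last first.
  by exists 0 => t /andP[pt tq]; move: (le_trans pt tq); rewrite leNgt qp.
have cn : {within `[p, q], continuous (fun t => `|f t|)}.
  apply: continuous_subspaceT => t.
  by apply: (continuous_comp (cf t)); exact: norm_continuous.
have [c _ cM] := EVT_max pq cn.
by exists `|f c| => t tpq; apply: cM; rewrite in_itv.
Qed.

Lemma lbm_cst (k : R) : lbm (fun=> k).
Proof. by apply: lbm_continuous => t; exact: cvg_cst. Qed.

Lemma lbmD f g : lbm f -> lbm g -> lbm (fun t => f t + g t).
Proof.
move=> [mf bf] [mg bg]; split; first exact: measurable_funD.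
move=> p q; have [C1 h1] := bf p q; have [C2 h2] := bg p q.
exists (C1 + C2) => t tpq; apply: le_trans (ler_normD _ _) _.
by apply: lerD; [exact: h1|exact: h2].
Qed.

Lemma lbmM f g : lbm f -> lbm g -> lbm (fun t => f t * g t).
Proof.
move=> [mf bf] [mg bg]; split; first exact: measurable_funM.
move=> p q; have [C1 h1] := bf p q; have [C2 h2] := bg p q.
exists (C1 * C2) => t tpq; rewrite normrM.
by apply: ler_pM => //; [exact: h1|exact: h2].
Qed.

Lemma lbmN f : lbm f -> lbm (fun t => - f t).
Proof.
move=> [mf bf]; split; first exact: measurableT_comp.
by move=> p q; have [C h] := bf p q; exists C => t tpq; rewrite normrN; exact: h.
Qed.

Lemma lbmB f g : lbm f -> lbm g -> lbm (fun t => f t - g t).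
Proof. by move=> lf lg; apply: lbmD => //; exact: lbmN. Qed.

Lemma lbm_if (b : R -> R) f g : measurable_fun [set: R] b -> lbm f -> lbm g ->
  lbm (fun t => if 0 < b t then f t else g t).
Proof.
move=> mb [mf bf] [mg bg]; split.
  apply: measurable_fun_ifT => //.
  by apply: measurable_fun_ltr => //; exact: measurable_cst.
move=> p q; have [C1 h1] := bf p q; have [C2 h2] := bg p q.
exists (Num.max C1 C2) => t tpq.
by case: ifP => _; rewrite le_max ?h1 ?h2 ?orbT.
Qed.

Lemma lbm_comp (f : R -> R) (g : R -> R) : lbm f -> continuous g ->
  lbm (fun t => f (g t)).
Proof.
move=> [mf bf] cg; split.
  by apply: measurableT_comp => //; exact: continuous_measurable_fun.
move=> p q; have [C hC] := (lbm_continuous cg).2 p q.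
have [C' hC'] := bf (- C) C; exists C' => t tpq.
by apply: hC'; rewrite -ler_norml; exact: hC.
Qed.

Lemma lbm_integrable f p q : lbm f ->
  lebesgue_measure.-integrable `[p, q] (EFin \o f).
Proof.
move=> [mf bf]; apply: measurable_bounded_integrable => //.
- rewrite /= lebesgue_measure_itv/=; case: ifP => _ //.
  by rewrite -EFinD ltry.
- exact: measurable_funTS.
- have [C hC] := bf p q; exists C; split; first exact: num_real.
  move=> M CM t /=; rewrite in_itv/= => tpq; exact: le_trans (hC t tpq) (ltW CM).
Qed.

Lemma lbm_ItvD f p r q : lbm f -> p <= r <= q ->
  \int[lebesgue_measure]_(t in `[p, q]) f t =
  \int[lebesgue_measure]_(t in `[p, r]) f t +
  \int[lebesgue_measure]_(t in `[r, q]) f t.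
Proof.
move=> lf /andP[pr rq].
have := @Rintegral_itvB _ f (BLeft p) (BRight q) r (lbm_integrable p q lf).
rewrite !bnd_simp => /(_ pr rq) E.
rewrite -(@Rintegral_itv_obnd_cbnd _ r (BRight q) f); last first.
  apply: integrableS (lbm_integrable r q lf) => //.
  by apply: subset_itvr; rewrite bnd_simp.
by rewrite -E addrC subrK.
Qed.

Lemma preimage_reflect (s p q : R) (b0 b1 : bool) :
  (fun t => s - t) @^-1` [set` Interval (BSide b0 p) (BSide b1 q)] =
  [set` Interval (BSide (~~ b1) (s - q)) (BSide (~~ b0) (s - p))].
Proof.
apply/seteqP; split=> t; rewrite /= !in_itv/=; case: b0; case: b1 => /=;
  move=> /andP[h1 h2]; apply/andP; split; lra.
Qed.

(** Lebesgue measure is determined by its values on half-open intervals, whose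
lengths a reflection preserves. *)
Lemma lebesgue_measure_reflect (s : R) (A : set R) : measurable A ->
  lebesgue_measure A =
  pushforward lebesgue_measure
    ((fun t => s - t) : measurableTypeR R -> measurableTypeR R) A.
Proof.
have mphi : measurable_fun setT
    ((fun t => s - t) : measurableTypeR R -> measurableTypeR R).
  exact: measurable_funB.
move=> mA; apply: lebesgue_measure_unique => //= _ [[a b]] _ <-.
rewrite /pushforward preimage_reflect/= !lebesgue_measure_itv/= !lte_fin.
rewrite ltrD2l ltrN2; case: ifP => // _; rewrite -!EFinD; congr (_%:E); lra.
Qed.

Lemma Int_reflect f (s p q : R) : lbm f ->
  \int[lebesgue_measure]_(t in `[p, q]) f (s - t) =
  \int[lebesgue_measure]_(u in `[s - q, s - p]) f u.
Proof.
move=> lf; have cs : continuous (fun t : R => s - t).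
  by move=> t; apply: cvgB; [exact: cvg_cst|exact: cvg_id].
have mphi : measurable_fun setT
    ((fun t => s - t) : measurableTypeR R -> measurableTypeR R).
  exact: measurable_funB.
have E : (fun t => s - t) @^-1` `[s - q, s - p] = `[p, q]%classic.
  by rewrite preimage_reflect/= !subKr.
rewrite /Rintegral; congr fine.
have := @integral_pushforward _ _ _ _ R _ mphi lebesgue_measure
  `[s - q, s - p]%classic (EFin \o f).
rewrite E => <- //=; first last.
- exact/(lbm_integrable p q)/lbm_comp.
- by apply/measurable_EFinP; case: lf.
- by apply: eq_measure_integral => //= A mA AS; rewrite -lebesgue_measure_reflect.
Qed.

(** A translation is the composite of two reflections. *)
Lemma Int_shift f (s p q : R) : lbm f ->
  \int[lebesgue_measure]_(t in `[p, q]) f (s + t) =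
  \int[lebesgue_measure]_(u in `[s + p, s + q]) f u.
Proof.
move=> lf.
have cs k : continuous (fun t : R => k - t).
  by move=> t; apply: cvgB; [exact: cvg_cst|exact: cvg_id].
have := @Int_reflect (fun t => f (s - t)) 0 p q (lbm_comp lf (cs s)).
under eq_Rintegral do rewrite sub0r opprK.
move=> ->; rewrite Int_reflect// !sub0r !opprK//.
Qed.

Lemma periodicZ (T : R) f (k : int) : (forall t, f (t + T) = f t) ->
  forall t, f (t + T *~ k) = f t.
Proof.
move=> per; have perN (n : nat) u : f (u + T *+ n) = f u.
  by elim: n u => [|n IH] u; rewrite ?addr0// mulrSr addrA per.
case: k => n t; first by rewrite perN.
by rewrite -[LHS](perN n.+1) NegzE mulrNz subrK.
Qed.

Lemma floor_period (T t : R) : 0 < T -> exists k : int, 0 <= t - T *~ k <= T.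
Proof.
move=> T0; exists (Num.floor (t / T)); set k := Num.floor _.
have := floor_itv (t / T); rewrite -/k => /andP[h1 h2].
have -> : t - T *~ k = t - k%:~R * T by rewrite -mulrzr mulrC.
apply/andP; split; first by rewrite subr_ge0 -ler_pdivlMr.
by move: h2; rewrite ltr_pdivrMr// intrD mulrDl mul1r => h2; lra.
Qed.

Lemma periodic_reduce (T : R) f g : 0 < T ->
  (forall t, f (t + T) = f t) -> (forall t, g (t + T) = g t) ->
  forall t, exists2 r, 0 <= r <= T & f t = f r /\ g t = g r.
Proof.
move=> T0 pf pg t; have [k rT] := floor_period t T0.
exists (t - T *~ k) => //; have -> : t = t - T *~ k + T *~ k by rewrite subrK.
by rewrite !periodicZ// addrK.
Qed.

(** Up to a whole number of periods, s lies in [0, T]; then the part of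
[s, s + T] beyond T is the translate by T of the missing part [0, s]. *)
Lemma Int_periodic f (T s : R) : 0 < T -> lbm f -> (forall t, f (t + T) = f t) ->
  \int[lebesgue_measure]_(t in `[s, s + T]) f t =
  \int[lebesgue_measure]_(t in `[0, T]) f t.
Proof.
move=> T0 lf per; have [k] := floor_period s T0; set r := s - _ => /andP[r0 rT].
have -> : s = T *~ k + r by rewrite addrC subrK.
rewrite -addrA -Int_shift//.
under eq_Rintegral do rewrite addrC periodicZ//.
rewrite (@lbm_ItvD f r T (r + T))//; last by rewrite rT lerDr.
rewrite -{2}[T]addr0 (addrC r) -(@Int_shift f T 0 r)//.
under [X in _ + X]eq_Rintegral do rewrite addrC per.
by rewrite addrC -lbm_ItvD// r0.
Qed.

Lemma eq_Int_oo f g (p q : R) : lbm f -> lbm g ->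
  (forall t, p < t < q -> f t = g t) ->
  \int[lebesgue_measure]_(t in `[p, q]) f t =
  \int[lebesgue_measure]_(t in `[p, q]) g t.
Proof.
move=> lf lg fg; rewrite /Rintegral; congr fine; apply: eq_integral_itv_bounded.
- by apply: measurable_funTS; case: lf.
- by apply: measurable_funTS; case: lg.
- by move=> t /[!in_itv]; exact: fg.
Qed.

Lemma Int0 (p q : R) : \int[lebesgue_measure]_(t in `[p, q]) (0 : R) = 0.
Proof. by rewrite Rintegral_cst ?mul0r. Qed.

Lemma Int_bound f (M u v : R) : lbm f -> u <= v ->
  (forall t, u <= t <= v -> `|f t| <= M) ->
  `|\int[lebesgue_measure]_(t in `[u, v]) f t| <= M * (v - u).
Proof.
move=> lf uv fM.
have len : fine (lebesgue_measure `[u, v]%classic) = v - u.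
  rewrite lebesgue_measure_itv/= lte_fin; case: ltP => // vu.
  by apply/esym/eqP; rewrite subr_eq0 eq_le uv vu.
have cstE (k : R) : \int[lebesgue_measure]_(t in `[u, v]) k = k * (v - u).
  by rewrite Rintegral_cst// len.
rewrite ler_norml -mulNr -!cstE; apply/andP; split; apply: le_Rintegral => //;
  try exact: lbm_integrable; try (apply: lbm_integrable; exact: lbm_cst).
- by move=> t /= /[!in_itv]/= /fM; rewrite ler_norml => /andP[].
- by move=> t /= /[!in_itv]/= /fM; rewrite ler_norml => /andP[].
Qed.

(** The integrand lives within distance rho of the end point w of the segment.
This measures what an oval contributes next to a turning point. *)
Lemma Int_edge (F : R -> R) (u v w M rho : R) : lbm F -> u <= v ->
  w = u \/ w = v -> 0 <= rho -> 0 <= M ->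
  (forall z, u <= z <= v -> `|F z| <= M) ->
  (forall z, u <= z <= v -> rho <= `|z - w| -> F z = 0) ->
  `|\int[lebesgue_measure]_(z in `[u, v]) F z| <= M * rho.
Proof.
move=> lF uv wuv rho0 M0 FM F0.
have zero u' v' : u <= u' -> v' <= v ->
    (forall z, u' < z < v' -> rho <= `|z - w|) ->
    \int[lebesgue_measure]_(z in `[u', v']) F z = 0.
  move=> uu' vv' far; rewrite -(Int0 u' v'); apply: eq_Int_oo => //.
    exact: lbm_cst.
  move=> z /[dup] zuv /far; apply: F0.
  by move: zuv => /andP[z1 z2]; rewrite (le_trans uu' (ltW z1)) (le_trans (ltW z2)).
have part u' v' : u <= u' -> u' <= v' -> v' <= v -> v' - u' <= rho ->
    `|\int[lebesgue_measure]_(z in `[u', v']) F z| <= M * rho.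
  move=> uu' uv' vv' len.
  apply: (@le_trans _ _ (M * (v' - u'))); last exact: ler_wpM2l.
  apply: Int_bound => // z /andP[z1 z2]; apply: FM.
  by rewrite (le_trans uu' z1) (le_trans z2).
case: wuv => ->{w} in zero F0 *.
- pose m := Num.min v (u + rho).
  have [m1 m2 m3] : [/\ u <= m, m <= v & m <= u + rho].
    by rewrite /m le_min !ge_min !lexx orbT uv; split => //; lra.
  rewrite (@lbm_ItvD F u m v)//; last by rewrite m1 m2.
  rewrite [X in _ + X]zero ?addr0//; first by apply: part => //; lra.
  move=> z /andP[+ zv]; rewrite /m gt_min ltNge (ltW zv)/= => z1.
  by apply: le_trans (ler_norm _); lra.
- pose m := Num.max u (v - rho).
  have [m1 m2 m3] : [/\ u <= m, m <= v & v - rho <= m].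
    by rewrite /m ge_max !le_max !lexx orbT uv; split => //; lra.
  rewrite (@lbm_ItvD F u m v)//; last by rewrite m1 m2.
  rewrite [X in X + _]zero ?add0r//; first by apply: part => //; lra.
  move=> z /andP[uz +]; rewrite /m lt_max ltNge (ltW uz)/= => z1.
  by rewrite distrC; apply: le_trans (ler_norm _); lra.
Qed.

Lemma Int_sum p q (I : Type) (s : seq I) (f : I -> R -> R) : (forall k, lbm (f k)) ->
  lbm (fun t => \sum_(k <- s) f k t) /\
  \int[lebesgue_measure]_(t in `[p, q]) (\sum_(k <- s) f k t) =
  \sum_(k <- s) \int[lebesgue_measure]_(t in `[p, q]) f k t.
Proof.
move=> lf; elim: s => [|k s [lIH IH]].
  rewrite big_nil; under eq_fun do rewrite big_nil; split; first exact: lbm_cst.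
  exact: Int0.
rewrite big_cons; under eq_fun do rewrite big_cons; split; first exact: lbmD.
by rewrite RintegralD ?IH//; exact: lbm_integrable.
Qed.

End Integrals.

(** * Calculus on the line *)

(** The chain rule for functions given pointwise, with the value of the derivative
left to a separate equation. *)
Lemma is_derive_chain (R : realType) (f g : R -> R) (t a b c : R) :
  is_derive (g t) 1 f a -> is_derive t 1 g b -> a * b = c ->
  is_derive t 1 (fun s => f (g s)) c.
Proof. by move=> hf hg <-; exact: (is_derive1_comp hf hg). Qed.

Lemma is_derive_continuous (R : realType) (f : R -> R) (t l : R) :
  is_derive t 1 f l -> {for t, continuous f}.
Proof. by move=> [df _]; apply/differentiable_continuous/derivable1_diffP. Qed.

Lemma is_derive_quotientP (R : realType) (f : R -> R) (a l : R) :
  is_derive a 1 f l <-> k^-1 * (f (a + k) - f a) @[k --> 0^'] --> l.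
Proof.
have E : (fun k => k^-1 * (f (a + k) - f a)) =
    (fun k : R => k^-1 *: ((f \o shift a) (k *: 1) - f a)).
  by apply/funext => k /=; rewrite scaler1 (addrC a).
rewrite E; split=> [[df dl]|cvgl].
- by rewrite -dl; exact: df.
- by apply: DeriveDef; [apply/cvg_ex; exists l|apply: cvg_lim].
Qed.

(** The difference quotient is O(sqrt |k|). *)
Lemma is_derive0_growth (R : realType) (f : R -> R) (a K : R) :
  (\forall k \near (0 : R), `|f (a + k) - f a| <= K * `|k| * Num.sqrt `|k|) ->
  is_derive a 1 f 0.
Proof.
move=> bnd; apply/is_derive_quotientP; apply/cvgr0Pnorm_lt => e e0.
have csq : (K * Num.sqrt `|k|) @[k --> (0 : R)] --> (0 : R).
  have csn : continuous (fun k : R => Num.sqrt `|k|).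
    by move=> z; apply: continuous_comp; [exact: norm_continuous|exact: sqrt_continuous].
  have := cvgM (@cvg_cst _ K _ (nbhs (0 : R)) _) (csn 0).
  by rewrite normr0 sqrtr0 mulr0; apply.
have := cvgr_lt _ csq _ e0 => /(_ _) small.
rewrite near_withinE; near=> k => k0.
rewrite normrM normfV mulrC ltr_pdivrMr ?normr_gt0//.
apply: le_lt_trans (_ : _ <= K * `|k| * Num.sqrt `|k|) _; first by near: k.
by rewrite mulrAC ltr_pM2r ?normr_gt0//; near: k; exact: small.
Unshelve. all: end_near. Qed.

Lemma is_derive_gt0_local (R : realType) (f : R -> R) (t l : R) :
  is_derive t 1 f l -> 0 < l -> exists2 e : R, 0 < e &
    (forall s, t < s < t + e -> f t < f s) /\
    (forall s, t - e < s < t -> f s < f t).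
Proof.
move=> [df dl] l0; rewrite -dl in l0.
have := cvgr_gt _ df _ l0 => /(_ _); rewrite near_withinE => /nbhs_ballP[e /= e0 he].
have main k : `|k| < e -> k != 0 -> 0 < k^-1 * (f (k + t) - f t).
  move=> ke k0; have := he k; rewrite /= scaler1; apply => //.
  by rewrite /ball /= sub0r normrN.
exists e => //; split=> s /andP[s1 s2].
- have k0 : 0 < s - t by rewrite subr_gt0.
  have := main (s - t); rewrite subrK gt_eqF// gtr0_norm// => H.
  have := H _ isT; rewrite pmulr_rgt0 ?invr_gt0// subr_gt0; apply; lra.
- have k0 : s - t < 0 by rewrite subr_lt0.
  have := main (s - t); rewrite subrK lt_eqF// ltr0_norm// => H.
  have := H _ isT; rewrite nmulr_rgt0 ?invr_lt0// subr_lt0; apply; lra.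
Qed.

Lemma is_derive_extremum_oo (R : realType) (f : R -> R) (a b t l : R) :
  a < t < b -> is_derive t 1 f l ->
  (forall s, a <= s <= b -> f s <= f t) -> l = 0.
Proof.
move=> /andP[a_t t_b] df ext; have [l0|l0|//] := ltgtP l 0; exfalso.
- have : is_derive t 1 (fun s => - f s) (- l) by exact: is_deriveN.
  move=> /is_derive_gt0_local[]; first by rewrite oppr_gt0.
  move=> e e0 [_ hl]; pose s := Num.max a (t - e / 2).
  have [s1 s2 s3] : [/\ a <= s, t - e < s & s < t].
    by rewrite /s le_max lexx lt_max gt_max; split => //; lra.
  have := hl s; rewrite s2 s3 ltrN2 => /(_ isT).
  by rewrite ltNge ext// s1/= ltW// (lt_trans s3).
- have [e e0 [hr _]] := is_derive_gt0_local df l0; pose s := Num.min b (t + e / 2).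
  have [s1 s2 s3] : [/\ s <= b, s < t + e & t < s].
    by rewrite /s ge_min lexx gt_min lt_min; split => //; lra.
  have := hr s; rewrite s2 s3 => /(_ isT).
  by rewrite ltNge ext// s1 andbT ltW// (lt_trans a_t).
Qed.

Lemma is_derive_extremum (R : realType) (f : R -> R) (t l : R) :
  is_derive t 1 f l ->
  (forall s, f s <= f t) \/ (forall s, f t <= f s) -> l = 0.
Proof.
move=> df ext; have t1 : t - 1 < t < t + 1 by apply/andP; split; lra.
case: ext => ext; first by apply: (is_derive_extremum_oo t1 df) => s _.
apply: oppr_inj; rewrite oppr0.
apply: (is_derive_extremum_oo t1 (is_deriveN df)) => s _.
by rewrite lerN2.
Qed.

Lemma is_derive_exprn (R : realType) (i : nat) (z : R) :
  is_derive z 1 (fun z : R => z ^+ i) (i%:R * z ^+ i.-1).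
Proof.
have -> : (fun z : R => z ^+ i) = horner 'X^i.
  by apply/funext => w; rewrite hornerXn.
apply: is_derive_eq (is_derive_poly _ _) _.
by rewrite derivXn hornerMn hornerXn mulr_natl.
Qed.

Lemma horner_lipschitz (R : realType) (q : {poly R}) (B : R) :
  exists2 C : R, 0 <= C & forall a b : R, `|a| <= B -> `|b| <= B ->
    `|q.[a] - q.[b]| <= C * `|a - b|.
Proof.
have [_ /(_ (- B) B) [C hC]] := lbm_continuous (@continuous_horner R q^`()).
exists (Num.max C 0); first by rewrite le_max lexx orbT.
move=> a b; wlog ab : a b / a <= b => [H aB bB|].
  have [ab|/ltW ba] := leP a b; first exact: H.
  by rewrite distrC (distrC a); exact: H.
move=> /ler_normlP[aB1 aB2] /ler_normlP[bB1 bB2].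
have [c cab E] := @MVT_segment R (horner q) (horner q^`()) a b ab
  (fun t _ => is_derive_poly q t)
  (continuous_subspaceT (@continuous_horner R q)).
rewrite distrC E normrM (distrC a); apply: ler_wpM2r => //.
rewrite le_max hC//; move: cab; rewrite in_itv/= => /andP[c1 c2].
by apply/andP; split; lra.
Qed.

(** Near a0 the derivative of q exceeds half its value at a0. *)
Lemma slope_window (R : realType) (q : {poly R}) (a0 : R) : 0 < q^`().[a0] ->
  exists del k : R, [/\ 0 < del, 0 < k &
    forall z w, `|z - a0| <= del -> `|w - a0| <= del -> z <= w ->
      k * (w - z) <= q.[w] - q.[z]].
Proof.
move=> qa; have half : q^`().[a0] / 2 < q^`().[a0] by lra.
have := cvgr_gt _ (@continuous_horner R q^`() a0) _ half => /(_ _) /nbhs_ballP[e /= e0 he].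
exists (e / 2), (q^`().[a0] / 2); split; [lra|lra|].
move=> z w /ler_normlP[z1 z2] /ler_normlP[w1 w2] zw.
have [s /[!in_itv]/= /andP[s1 s2] ->] := @MVT_segment R (horner q) (horner q^`()) z w zw
  (fun t _ => is_derive_poly q t) (continuous_subspaceT (@continuous_horner R q)).
apply: ler_wpM2r; first by rewrite subr_ge0.
by apply/ltW/he; rewrite /ball/= ltr_distlC; apply/andP; split; lra.
Qed.

(** A root splits off a linear factor and lowers the degree. *)
Lemma finite_roots (R : idomainType) (q : {poly R}) : q != 0 ->
  finite_set [set z | root q z].
Proof.
have [n] := ubnP (size q); elim: n q => // n IH q; rewrite ltnS => sq q0.
have [[z rz]|nor] := pselect (exists z, root q z); last first.
  by rewrite (_ : mkset _ = set0)// -subset0 => z rz; apply: nor; exists z.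
have /factor_theorem[q' qE] := rz.
have q'0 : q' != 0 by apply: contraNneq q0 => q'0; rewrite qE q'0 mul0r.
have sq' : (size q' < n)%N.
  by apply: leq_trans sq; rewrite qE size_Mmonic ?monicXsubC// size_XsubC addn2.
apply: (@sub_finite_set _ _ ([set z] `|` [set w | root q' w])).
  move=> w /=; rewrite qE rootM root_XsubC => /orP[rw|/eqP ->]; by [right|left].
by rewrite finite_setU; split; [exact: finite_set1|exact: IH].
Qed.

(** The Lipschitz constant K dominates the difference quotients, so dominated
convergence applies; finitely many exceptional t leave room for integrands that
jump when t crosses the separation line. *)
Lemma derive_under_Int (R : realType) (f : R -> R -> R) (g : R -> R)
    (h0 u v K : R) (Z : set R) :
  (forall h, lbm (f h)) -> lbm g -> finite_set Z ->
  (forall h t, u <= t <= v -> `|f h t - f h0 t| <= K * `|h - h0|) ->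
  (forall t, u <= t <= v -> ~ Z t -> is_derive h0 1 (f^~ t) (g t)) ->
  is_derive h0 1 (fun h => \int[lebesgue_measure]_(t in `[u, v]) f h t)
    (\int[lebesgue_measure]_(t in `[u, v]) g t).
Proof.
move=> lf lg finZ lip df; apply/is_derive_quotientP/cvgr_dnbhsP => k [kn0 k0].
pose q n t := (k n)^-1 * (f (h0 + k n) t - f h0 t).
have lq n : lbm (q n).
  by apply: lbmM; [exact: lbm_cst|exact: lbmB].
have qE n : (k n)^-1 * (\int[lebesgue_measure]_(t in `[u, v]) f (h0 + k n) t -
    \int[lebesgue_measure]_(t in `[u, v]) f h0 t) =
    \int[lebesgue_measure]_(t in `[u, v]) q n t.
  rewrite -RintegralB//; try exact: lbm_integrable.
  rewrite -RintegralZl//; apply: lbm_integrable; exact: lbmB.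
under eq_fun do rewrite qE.
have aeZ (P : R -> Prop) : (forall t, u <= t <= v -> ~ Z t -> P t) ->
    {ae lebesgue_measure, forall t : R, `[u, v]%classic t -> P t}.
  move=> H; have Z0 : lebesgue_measure.-negligible Z.
    have cZ := finite_set_countable finZ.
    exists Z; split => //; last exact: countable_lebesgue_measure0.
    exact: countable_measurable.
  apply: negligibleS Z0 => t /= nP; apply: contrapT => nZ; apply: nP.
  by rewrite in_itv/= => tuv; exact: H.
have mq n : measurable_fun `[u, v]%classic (fun t => (q n t)%:E).
  by apply/measurable_EFinP/measurable_funTS; case: (lq n).
have mg : measurable_fun `[u, v]%classic (fun t => (g t)%:E).
  by apply/measurable_EFinP/measurable_funTS; case: lg.
have cvq : {ae lebesgue_measure, forall t : R, `[u, v]%classic t ->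
    (q n t)%:E @[n --> \oo] --> (g t)%:E}.
  apply: aeZ => t tuv nZ; apply: cvg_EFin; first exact: nearW.
  have := df t tuv nZ => /is_derive_quotientP/cvgr_dnbhsP; apply.
  by split.
have bq : {ae lebesgue_measure, forall (t : R) n, `[u, v]%classic t ->
    (`|(q n t)%:E| <= K%:E)%E}.
  apply: aeW => t n /= /[!in_itv]/= tuv.
  rewrite lee_fin /q normrM normfV mulrC ler_pdivrMr ?normr_gt0//.
  by have := lip (h0 + k n) t tuv; rewrite (addrC h0) addrK addrC.
have iK := lbm_integrable u v (lbm_cst K).
have [ig _ cv] := @dominated_convergence _ _ R lebesgue_measure `[u, v]%classic
  (measurable_itv _) (fun n t => (q n t)%:E) (fun t => (g t)%:E) (fun=> K%:E)
  mq mg cvq iK bq.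
rewrite /Rintegral; apply: fine_cvg.
rewrite fineK; first exact: cv.
by apply: integrable_fin_num.
Qed.

(** * Newton equations *)

Section Newton.
Variables (R : realType) (p : {poly R}).
Implicit Types x y u v : R -> R.

(** Newton's equation x'' = - p'(x) as a first-order system. *)
Definition solves x y : Prop :=
  forall t : R, is_derive t 1 x (y t) /\ is_derive t 1 y (- p^`().[x t]).

Lemma solves_continuous x y : solves x y -> continuous x /\ continuous y.
Proof.
by move=> s; split=> t; have [h1 h2] := s t;
  [exact: is_derive_continuous h1|exact: is_derive_continuous h2].
Qed.

Lemma solves_shift x y (s : R) : solves x y ->
  solves (fun t => x (s + t)) (fun t => y (s + t)).
Proof.
move=> sol t; have [h1 h2] := sol (s + t).
have hs : is_derive t 1 (fun t : R => s + t) 1 by apply: is_derive_eq; rewrite add0r mul1r.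
split.
- by apply: (is_derive_chain h1 hs); rewrite mulr1.
- by apply: (is_derive_chain h2 hs); rewrite mulr1.
Qed.

Lemma solves_reflect x y (s : R) : solves x y ->
  solves (fun t => x (s - t)) (fun t => - y (s - t)).
Proof.
move=> sol t; have [h1 h2] := sol (s - t).
have hs : is_derive t 1 (fun t : R => s - t) (-1) by apply: is_derive_eq; rewrite add0r mul1r.
split.
- by apply: (@is_derive_chain _ x (fun t => s - t) t _ _ _ h1 hs); rewrite mulrN1.
- have h := @is_derive_chain _ y (fun t => s - t) t _ _ _ h2 hs erefl.
  by apply: (is_derive_eq (is_deriveN h)); rewrite mulrN1 opprK.
Qed.

(** Gronwall's argument: if C is a Lipschitz constant of p' on a segment containing
both trajectories, the squared distance E of the two phase points satisfies
E' <= (1 + C) E, so that E(t) exp (- (1 + C) t) cannot leave 0. *)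
Let solves_uniq_ge0 x y u v (t : R) : solves x y -> solves u v ->
  x 0 = u 0 -> y 0 = v 0 -> 0 <= t -> x t = u t /\ y t = v t.
Proof.
move=> sxy suv x0 y0; rewrite le_eqVlt => /predU1P[<-//|t0].
have [cx cy] := solves_continuous sxy; have [cu cv] := solves_continuous suv.
have [_ /(_ 0 t) [B1 hB1]] := lbm_continuous cx.
have [_ /(_ 0 t) [B2 hB2]] := lbm_continuous cu.
have [C C0 hC] := horner_lipschitz p^`() (Num.max B1 B2).
pose E s := (x s - u s) ^+ 2 + (y s - v s) ^+ 2.
pose F s := E s * expR (- (1 + C) * s).
pose dF s := (2 * (x s - u s) * (y s - v s) -
   2 * (y s - v s) * (p^`().[x s] - p^`().[u s]) - (1 + C) * E s)
   * expR (- (1 + C) * s).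
have dFP (s : R) : is_derive s 1 F (dF s).
  have [h1 h2] := sxy s; have [h3 h4] := suv s.
  have h5 : is_derive s 1 (fun s : R => expR (- (1 + C) * s))
      (expR (- (1 + C) * s) * - (1 + C)).
    have h : is_derive s 1 (fun s : R => - (1 + C) * s) (- (1 + C)).
      by apply: is_derive_eq; rewrite /GRing.scale/= mulr1.
    exact: (is_derive_chain _ h erefl).
  apply: is_derive_eq; rewrite /dF /E /GRing.scale/=; ring.
have dF0 (s : R) : 0 <= s <= t -> dF s <= 0.
  move=> st; rewrite /dF pmulr_lle0 ?expR_gt0// subr_le0.
  have : `|p^`().[x s] - p^`().[u s]| <= C * `|x s - u s|.
    by apply: hC; rewrite le_max ?hB1 ?hB2 ?orbT.
  rewrite /E; set X := x s - u s; set Y := y s - v s; set D := _.[_] - _ => hD.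
  have h1 : `|2 * X * Y| <= X ^+ 2 + Y ^+ 2.
    rewrite ler_norml; apply/andP; split.
      by have := sqr_ge0 (X + Y); nra.
    by have := sqr_ge0 (X - Y); nra.
  have h2 : `|2 * Y * D| <= C * (X ^+ 2 + Y ^+ 2).
    rewrite normrM; apply: (@le_trans _ _ (`|2 * Y| * (C * `|X|))).
      exact: ler_wpM2l.
    rewrite mulrCA; apply: ler_wpM2l => //.
    by rewrite -normrM (_ : 2 * Y * X = 2 * X * Y)//; ring.
  apply: le_trans (ler_norm _) _; apply: le_trans (ler_normB _ _) _.
  by move: h1 h2; set n1 := `|_|; set n2 := `|_| => h1 h2; lra.
have F0 : F 0 = 0 by rewrite /F /E x0 y0 !subrr !expr0n/= addr0 mul0r.
have Ft : F t <= 0.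
  have [c] := @MVT R F dF 0 t t0 (fun s _ => dFP s)
    (continuous_subspaceT (fun s => is_derive_continuous (dFP s))).
  rewrite in_itv/= => /andP[c0 ct]; rewrite F0 !subr0 => ->.
  by rewrite pmulr_lle0// dF0// !ltW.
have Et : E t <= 0 by move: Ft; rewrite /F pmulr_lle0 ?expR_gt0.
have := sqr_ge0 (x t - u t); have := sqr_ge0 (y t - v t).
move: Et; rewrite /E => Et hy hx.
have /eqP : (x t - u t) ^+ 2 = 0 by lra.
have /eqP : (y t - v t) ^+ 2 = 0 by lra.
by rewrite !expf_eq0/= !subr_eq0 => /eqP -> /eqP ->.
Qed.

(** Negative times reduce to positive ones because reversing time and changing the
sign of y maps solutions to solutions. *)
Lemma solves_uniq x y u v (s s' : R) : solves x y -> solves u v ->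
  x s = u s' -> y s = v s' ->
  forall t, x (s + t) = u (s' + t) /\ y (s + t) = v (s' + t).
Proof.
move=> sxy suv xs ys t.
have [t0|t0] := leP 0 t.
  have := @solves_uniq_ge0 _ _ _ _ t (solves_shift s sxy) (solves_shift s' suv).
  by rewrite !addr0; apply.
have := @solves_uniq_ge0 _ _ _ _ (- t)
  (solves_reflect s sxy) (solves_reflect s' suv).
rewrite !subr0 !opprK; case=> //; first by rewrite ys.
  by rewrite oppr_ge0 ltW.
by move=> -> /oppr_inj.
Qed.

End Newton.

(** * Periodic orbits as ovals *)

Section Oval.
Variables (R : realType) (p : {poly R}).
Implicit Types x y : R -> R.

(** The closed orbit of energy h, started at its leftmost point (a, 0) and moving
to the right until it reaches its rightmost point (d, 0) at time S. The way back,
from S to 2 S, is the mirror image of the way out. The signs of the slopes say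
that neither turning point is an equilibrium. *)
Record oval (h a d S : R) x y : Prop := Oval {
  oval_solves : solves p x y ;
  oval_energy : forall t, y t ^+ 2 = 2 * (h - p.[x t]) ;
  oval_S_gt0 : 0 < S ;
  oval_x0 : x 0 = a ;
  oval_y0 : y 0 = 0 ;
  oval_xS : x S = d ;
  oval_yS : y S = 0 ;
  oval_y_gt0 : forall t, 0 < t < S -> 0 < y t ;
  oval_slope_a : p^`().[a] < 0 ;
  oval_slope_d : 0 < p^`().[d] ;
  oval_inside : forall z, a < z < d -> p.[z] < h }.

Lemma solves_cst (c : R) : p^`().[c] = 0 -> solves p (fun=> c) (fun=> 0).
Proof.
move=> pc t; split; first exact: is_derive_cst.
by rewrite pc oppr0; exact: is_derive_cst.
Qed.

(** By uniqueness a nonconstant orbit contains no equilibrium. Where x is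
extremal, y = 0, hence p = h and p' does not vanish. In between p <= h by
conservation of energy, and equality would be an interior maximum of p, that is,
an equilibrium on the orbit. The time S is the first zero of y after the orbit
leaves its leftmost point. *)
Lemma oval_of_periodic (h T : R) x y :
  solves p x y -> 0 < T ->
  (forall t, x (t + T) = x t) -> (forall t, y (t + T) = y t) ->
  (exists t, (x t, y t) <> (x 0, y 0)) ->
  (forall t, y t ^+ 2 = 2 * (h - p.[x t])) ->
  exists a d S s, oval h a d S (fun t => x (s + t)) (fun t => y (s + t)).
Proof.
move=> sol T0 px py [t0 ncst] en.
have [cx cy] := solves_continuous sol.
have noeq t : y t = 0 -> p^`().[x t] <> 0.
  move=> yt pt; apply: ncst.
  have U := @solves_uniq _ _ _ _ _ _ t 0 sol (solves_cst pt) erefl yt.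
  by have := U (t0 - t); have := U (0 - t); rewrite !(addrC t) !subrK => -[-> ->] [-> ->].
have red := periodic_reduce T0 px py.
have [ta /[!in_itv]/= /andP[ta0 taT] tamin'] := EVT_min (ltW T0) (continuous_subspaceT cx).
have [td /[!in_itv]/= /andP[td0 tdT] tdmax'] := EVT_max (ltW T0) (continuous_subspaceT cx).
have tamin t : x ta <= x t by have [r rT [-> _]] := red t; apply: tamin'; rewrite in_itv.
have tdmax t : x t <= x td by have [r rT [-> _]] := red t; apply: tdmax'; rewrite in_itv.
have yta : y ta = 0 by apply: is_derive_extremum (sol ta).1 _; right.
have ytd : y td = 0 by apply: is_derive_extremum (sol td).1 _; left.
have lt_ad : x ta < x td.
  rewrite lt_neqAle tdmax andbT; apply/eqP => ad; apply: ncst.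
  have xc t : x t = x ta by apply/eqP; rewrite eq_le tamin ad tdmax.
  have yc t : y t = 0.
    apply: is_derive_extremum (sol t).1 _; left => s.
    by rewrite !xc.
  by rewrite !xc !yc.
have onto z : x ta <= z <= x td -> exists t, x t = z.
  move=> /andP[z1 z2].
  have [tad|/ltW tad] := leP ta td.
    have [|c _ <-] := @IVT R x ta td z tad (continuous_subspaceT cx); last by exists c.
    by rewrite ge_min z1 le_max z2 orbT.
  have [|c _ <-] := @IVT R x td ta z tad (continuous_subspaceT cx); last by exists c.
  by rewrite ge_min z1 le_max z2 orbT.
have ple z : x ta <= z <= x td -> p.[z] <= h.
  by move=> /onto[t <-]; have := en t; have := sqr_ge0 (y t); lra.
have pa : p.[x ta] = h by have := en ta; rewrite yta expr0n/=; lra.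
have pd : p.[x td] = h by have := en td; rewrite ytd expr0n/=; lra.
have slope_a : p^`().[x ta] < 0.
  rewrite lt_neqAle; apply/andP; split; first by apply/eqP; exact: noeq.
  rewrite leNgt; apply/negP => /(is_derive_gt0_local (is_derive_poly p (x ta))).
  move=> [e e0 [hr _]]; pose z := Num.min (x td) (x ta + e / 2).
  have [z1 z2 z3] : [/\ x ta < z, z < x ta + e & z <= x td].
    by rewrite /z lt_min gt_min ge_min lexx; split => //; lra.
  have := hr z; rewrite z1 z2 => /(_ isT); rewrite pa ltNge ple//.
  by rewrite (ltW z1).
have slope_d : 0 < p^`().[x td].
  rewrite lt_neqAle eq_sym; apply/andP; split; first by apply/eqP; exact: noeq.
  rewrite leNgt; apply/negP => sl.
  have : is_derive (x td) 1 (fun s => - p.[s]) (- p^`().[x td]).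
    exact: (is_deriveN (is_derive_poly p (x td))).
  move=> /is_derive_gt0_local; rewrite oppr_gt0 => /(_ sl).
  move=> [e e0 [_ hl]]; pose z := Num.max (x ta) (x td - e / 2).
  have [z1 z2 z3] : [/\ x ta <= z, x td - e < z & z < x td].
    by rewrite /z le_max gt_max lt_max lexx; split => //; lra.
  have := hl z; rewrite z2 z3 => /(_ isT); rewrite pd ltrN2 ltNge ple//.
  by rewrite z1 (ltW z3).
have inside z : x ta < z < x td -> p.[z] < h.
  move=> zad; have /andP[z1 z2] := zad.
  have zad' : x ta <= z <= x td by rewrite !ltW.
  rewrite lt_neqAle ple// andbT; apply/eqP => pz.
  have [t xt] := onto _ zad'.
  apply: (@noeq t).
    by have := en t; rewrite xt pz subrr mulr0 => /eqP; rewrite expf_eq0/= => /eqP.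
  rewrite xt; apply: (is_derive_extremum_oo zad (is_derive_poly p z)).
  by move=> s /ple; rewrite pz.
pose X t := x (ta + t); pose Y t := y (ta + t).
have solXY : solves p X Y by exact: solves_shift.
have [cX cY] := solves_continuous solXY.
have Y0 : Y 0 = 0 by rewrite /Y addr0.
have [e e0 [hr _]] : exists2 e : R, 0 < e &
    (forall s, 0 < s < 0 + e -> Y 0 < Y s) /\ (forall s, 0 - e < s < 0 -> Y s < Y 0).
  apply: (is_derive_gt0_local (solXY 0).2).
  by rewrite /X addr0 oppr_gt0.
have Ypos s : 0 < s < e -> 0 < Y s by move=> h1; rewrite -Y0; apply: hr; rewrite add0r.
(* A period is added because td may precede ta. *)
pose S' := td + T - ta.
have YS' : Y S' = 0 by rewrite /Y /S' addrCA subrr addr0 py.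
have XS' : X S' = x td by rewrite /X /S' addrCA subrr addr0 px.
have S'0 : 0 < S'.
  rewrite lt_neqAle; apply/andP; split; last by rewrite /S'; lra.
  apply/eqP => S'0; move: XS'; rewrite -S'0 /X addr0 => E.
  by move: lt_ad; rewrite E ltxx.
have eS' : e <= S'.
  by rewrite leNgt; apply/negP => lt; have := Ypos S'; rewrite S'0 lt YS' ltxx => /(_ isT).
(* As y > 0 on ]0, e[, the zeros of y in [e / 2, S'] form a compact set of
   positive times. *)
pose Z := `[e / 2, S']%classic `&` (Y @^-1` [set 0]).
have cZ : compact Z.
  apply: compact_closedI; first exact: segment_compact.
  by apply: closed_comp => [t _|]; [exact: cY|exact: closed_eq].
have Z0 : Z !=set0 by exists S'; split => //=; rewrite in_itv/=; lra.
have [S /set_mem[/= /[!in_itv]/= /andP[S1 S2] YS] Smin] :=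
  compact_EVT_min Z0 cZ (continuous_subspaceT (fun t : R => @cvg_id R (nbhs t))).
have S0 : 0 < S by lra.
have Ygt0 t : 0 < t < S -> 0 < Y t.
  move=> /andP[t_0 tS]; have [te|te] := ltP t e; first by apply: Ypos; rewrite t_0.
  have nz u : e / 2 <= u -> u < S -> Y u != 0.
    move=> u1 u2; apply/eqP => Yu; have := Smin u; rewrite inE leNgt u2.
    move=> H; suff : false by []. apply: H; split => //=; rewrite in_itv/=; lra.
  rewrite ltNge; apply/negP => Yt0.
  have et : e / 2 <= t by lra.
  have Ye : 0 < Y (e / 2) by apply: Ypos; lra.
  have [|c /[!in_itv]/= /andP[c1 c2] Yc] := @IVT R Y _ _ 0 et (continuous_subspaceT cY).
    by rewrite ge_min Yt0 orbT le_max ltW.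
  have := nz c c1 (le_lt_trans c2 tS); by rewrite Yc eqxx.
have XS : X S = x td.
  have [c /[!in_itv]/= cS] := MVT S0 (fun u _ => (solXY u).1) (continuous_subspaceT cX).
  rewrite subr0 /X addr0 => E.
  have gta : x ta < x (ta + S) by rewrite -subr_gt0 E mulr_gt0// Ygt0.
  apply/eqP; rewrite eq_le tdmax leNgt; apply/negP => ltd.
  have := inside (x (ta + S)); rewrite gta ltd => /(_ isT).
  by have := en (ta + S); move: YS; rewrite /Y => ->; rewrite expr0n/=; lra.
exists (x ta), (x td), S, ta; split => //; first by rewrite addr0.
Qed.

End Oval.

(** * Arcs of an oval cut off by a line *)

Lemma sepline_continuous (R : realType) (theta c : R) (f g : R -> R) :
  continuous f -> continuous g ->
  continuous (fun t => sepline theta c (f t) (g t)).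
Proof.
move=> cf cg t; rewrite /sepline; apply: cvgB; apply: cvgM;
  [exact: cvg_cst|apply: cvgB; [exact: cf|exact: cvg_cst]|exact: cvg_cst|exact: cg].
Qed.

Definition on_side (R : realType) (theta c : R) (f : R -> R -> R) (X Y : R) : R :=
  if 0 < sepline theta c X Y then f X Y else 0.

Lemma lbm_on_side (R : realType) (theta c : R) (f : R -> R -> R) (X Y : R -> R) :
  continuous X -> continuous Y -> lbm (fun t => f (X t) (Y t)) ->
  lbm (fun t => on_side theta c f (X t) (Y t)).
Proof.
move=> cX cY lf; apply: lbm_if => //; last exact: lbm_cst.
by apply: continuous_measurable_fun; exact: sepline_continuous.
Qed.

Section OvalTheory.
Variables (R : realType) (p : {poly R}) (h a d S : R) (x y : R -> R).
Hypothesis ov : oval p h a d S x y.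

Let sol := oval_solves ov.
Let S0 := oval_S_gt0 ov.

(** Time reversal followed by reflection in the x-axis fixes the state (a, 0) at
time 0; [oval_reflect] uses the state (d, 0) at time S in the same way. *)
Lemma ovalN t : x (- t) = x t /\ y (- t) = - y t.
Proof.
have := @solves_uniq _ _ _ _ _ _ 0 0 (solves_reflect 0 sol) sol.
rewrite !subr0 (oval_y0 ov) oppr0 => /(_ erefl erefl (- t)).
by rewrite !add0r opprK => -[-> <-].
Qed.

Lemma oval_reflect t : x (S + t) = x (S - t) /\ y (S + t) = - y (S - t).
Proof.
have := @solves_uniq _ _ _ _ _ _ S 0 sol (solves_reflect S sol).
rewrite !subr0 (oval_yS ov) oppr0 => /(_ erefl erefl t).
by rewrite !add0r.
Qed.

Lemma oval_periodic t : x (t + 2 * S) = x t /\ y (t + 2 * S) = y t.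
Proof.
have -> : t + 2 * S = S + (t + S) by ring.
have [-> ->] := oval_reflect (t + S).
have -> : S - (t + S) = - t by ring.
by have [-> ->] := ovalN t; rewrite opprK.
Qed.

Lemma oval_x_incr s t : 0 <= s -> s < t -> t <= S -> x s < x t.
Proof.
move=> s0 st tS.
have [c /[!in_itv]/= /andP[c1 c2] E] := MVT st (fun u _ => (sol u).1)
  (continuous_subspaceT (solves_continuous sol).1).
rewrite -subr_gt0 E mulr_gt0 ?subr_gt0//; apply: (oval_y_gt0 ov); lra.
Qed.

Lemma oval_lt_ad : a < d.
Proof. by rewrite -(oval_x0 ov) -(oval_xS ov) oval_x_incr. Qed.

Lemma oval_y_ge0 t : 0 <= t <= S -> 0 <= y t.
Proof.
move=> /andP[]; rewrite le_eqVlt => /predU1P[<- _|t0]; first by rewrite (oval_y0 ov).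
rewrite le_eqVlt => /predU1P[->|tS]; first by rewrite (oval_yS ov).
by apply/ltW/(oval_y_gt0 ov); rewrite t0.
Qed.

(** The abscissa increases on [0, S] and decreases on [S, 2 S], so it does not
return to a in between. *)
Lemma oval_minimal_period u v : x u = x v -> y u = y v -> u < v -> 2 * S <= v - u.
Proof.
move=> xuv yuv uv; rewrite leNgt; apply/negP => lt.
have [+ _] := solves_uniq sol sol xuv yuv (- u).
rewrite subrr; set w := v - u in lt *; have w0 : 0 < w by rewrite subr_gt0.
apply/eqP; have [wS|Sw] := leP w S; first by rewrite lt_eqF// oval_x_incr.
have -> : w = S + (w - S) by ring.
by rewrite (oval_reflect _).1 lt_eqF// oval_x_incr//; lra.
Qed.

Section Arc.
Variables (theta c : R) (u v : R -> R) (t1 t2 : R).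
Local Notation L := (sepline theta c).
Hypothesis suv : solves p u v.
Hypothesis t12 : t1 < t2.
Hypothesis inj : forall s t, t1 < s < t2 -> t1 < t < t2 ->
  u s = u t -> v s = v t -> s = t.
Hypothesis im_arc : forall t, t1 < t < t2 ->
  (exists s, u t = x s /\ v t = y s) /\ 0 < L (u t) (v t).
Hypothesis arc_onto : forall s, 0 < L (x s) (y s) ->
  exists2 t, t1 < t < t2 & u t = x s /\ v t = y s.

Lemma arc_shift : exists s, forall t, u t = x (s + t) /\ v t = y (s + t).
Proof.
have [|[s [us vs]] _] := @im_arc ((t1 + t2) / 2); first by have := t12; lra.
exists (s - (t1 + t2) / 2) => t.
have := solves_uniq suv sol us vs (t - (t1 + t2) / 2).
have -> : (t1 + t2) / 2 + (t - (t1 + t2) / 2) = t by rewrite addrC subrK.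
by have -> : s + (t - (t1 + t2) / 2) = s - (t1 + t2) / 2 + t by ring.
Qed.

Let cuv := solves_continuous suv.
Let cL := @sepline_continuous R theta c u v cuv.1 cuv.2.

(** By continuity L >= 0 at the starting point. If L > 0, this point would be
visited again at a time s inside the arc, and the orbit would run through the same
points from t1 and from s on, against injectivity. *)
Lemma arc_end1 : L (u t1) (v t1) = 0.
Proof.
have T12 := t12.
have [s0 shift] := arc_shift.
apply/eqP; rewrite eq_le; apply/andP; split; last first.
  rewrite leNgt; apply/negP => neg.
  have := cvgr_lt _ (@cL t1) _ neg => /(_ _) /nbhs_ballP[e /= e0 he].
  pose s := Num.min ((t1 + t2) / 2) (t1 + e / 2).
  have [s1 s2 s3] : [/\ t1 < s, s < t2 & s < t1 + e].
    by rewrite /s lt_min !gt_min; split => //;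
      [apply/andP; split; lra|apply/orP; left; lra|apply/orP; right; lra].
  have : L (u s) (v s) < 0 by apply: he; rewrite /ball/= ltr_distlC; lra.
  have [_] := @im_arc s ltac:(by rewrite s1 s2).
  by move=> /lt_trans/[apply]; rewrite ltxx.
rewrite leNgt; apply/negP => pos.
have [ut vt] := shift t1.
have := pos; rewrite ut vt => /arc_onto[s st [us vs]].
rewrite -ut -vt in us vs.
(* After a delay of k both times still lie inside the arc. *)
pose k := (t2 - s) / 2.
have := @inj (t1 + k) (s + k); rewrite /k.
have [E1 E2] := solves_uniq suv suv us vs k.
rewrite /k in E1 E2; rewrite E1 E2; lra.
Qed.

(** As for the starting point, with the two times moved backwards. *)
Lemma arc_end2 : L (u t2) (v t2) = 0.
Proof.
have T12 := t12.
have [s0 shift] := arc_shift.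
apply/eqP; rewrite eq_le; apply/andP; split; last first.
  rewrite leNgt; apply/negP => neg.
  have := cvgr_lt _ (@cL t2) _ neg => /(_ _) /nbhs_ballP[e /= e0 he].
  pose s := Num.max ((t1 + t2) / 2) (t2 - e / 2).
  have [s1 s2 s3] : [/\ t1 < s, s < t2 & t2 - e < s].
    by rewrite /s gt_max !lt_max; split => //; [apply/orP; left; lra|lra|apply/orP; right; lra].
  have : L (u s) (v s) < 0 by apply: he; rewrite /ball/= ltr_distlC; lra.
  have [_] := @im_arc s ltac:(by rewrite s1 s2).
  by move=> /lt_trans/[apply]; rewrite ltxx.
rewrite leNgt; apply/negP => pos.
have [ut vt] := shift t2.
have := pos; rewrite ut vt => /arc_onto[s st [us vs]].
rewrite -ut -vt in us vs.
pose k := (s - t1) / 2.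
have := @inj (t2 - k) (s - k); rewrite /k.
have [E1 E2] := solves_uniq suv suv us vs (- k).
rewrite /k in E1 E2; rewrite E1 E2; lra.
Qed.

(** Otherwise two times inside the arc would differ by the period 2 S. *)
Lemma arc_duration : t2 <= t1 + 2 * S.
Proof.
have T12 := t12.
have [s0 shift] := arc_shift.
rewrite leNgt; apply/negP => lt.
pose k := t1 + (t2 - (t1 + 2 * S)) / 2.
have := @inj (k + 2 * S) k.
have [E1 E2] := shift (k + 2 * S); have [E3 E4] := shift k.
have [P1 P2] := oval_periodic (s0 + k).
rewrite E1 E2 E3 E4 addrA P1 P2 /k; have := S0; lra.
Qed.

(** A point on the positive side has been visited at some time s inside the arc,
and t - s would be less than the minimal period. *)
Lemma arc_complement t : t2 <= t <= t1 + 2 * S -> L (u t) (v t) <= 0.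
Proof.
move=> /andP[tt2 tS].
have [s0 shift] := arc_shift.
rewrite leNgt; apply/negP => pos.
have [ut vt] := shift t.
have := pos; rewrite ut vt => /arc_onto[s /andP[st1 st2] [us vs]].
have [us' vs'] := shift s.
rewrite us' in us; rewrite vs' in vs.
have := oval_minimal_period us vs; lra.
Qed.

(** The arc is the part of one full period spent on the positive side of the line.
Choosing the period [- S, S] and folding it at 0 pairs the state (x, y) at time t
with its mirror image (x, - y) at time - t. *)
Lemma arc_fold (f : R -> R -> R) :
  (forall X Y : R -> R, continuous X -> continuous Y ->
     lbm (fun t => f (X t) (Y t))) ->
  \int[lebesgue_measure]_(t in `[t1, t2]) f (u t) (v t) =
  \int[lebesgue_measure]_(t in `[0, S])
     (on_side theta c f (x t) (y t) + on_side theta c f (x t) (- y t)).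
Proof.
move=> lf; have [cx cy] := solves_continuous sol; have [cu cv] := cuv.
pose G t := on_side theta c f (u t) (v t); pose G0 t := on_side theta c f (x t) (y t).
have lG : lbm G by apply: lbm_on_side => //; exact: lf.
have lG0 : lbm G0 by apply: lbm_on_side => //; exact: lf.
have luv : lbm (fun t => f (u t) (v t)) by exact: lf.
rewrite (eq_Int_oo luv lG); last first.
  by move=> t tt; rewrite /G /on_side; have [_ ->] := im_arc tt.
transitivity (\int[lebesgue_measure]_(t in `[t1, t1 + 2 * S]) G t).
  rewrite (@lbm_ItvD _ G t1 t2 (t1 + 2 * S))//; last by rewrite (ltW t12) arc_duration.
  rewrite [X in _ + X](_ : _ = 0) ?addr0//.
  rewrite (_ : 0 = \int[lebesgue_measure]_(t in `[t2, t1 + 2 * S]) 0).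
    apply: eq_Rintegral => t; rewrite inE/= in_itv/= => /arc_complement.
    by rewrite /G /on_side leNgt => /negbTE ->.
  by rewrite Rintegral_cst ?mul0r.
have [s shift] := arc_shift.
have GE t : G t = G0 (s + t) by have [ut vt] := shift t; rewrite /G ut vt.
under eq_Rintegral do rewrite GE.
have per t : G0 (t + 2 * S) = G0 t.
  by have [pX pY] := oval_periodic t; rewrite /G0 pX pY.
have S20 : 0 < 2 * S by rewrite mulr_gt0.
rewrite Int_shift// addrA Int_periodic// -(@Int_periodic _ _ (2 * S) (- S))//.
rewrite (@lbm_ItvD _ G0 _ 0); [|exact: lG0|by have := S0; lra].
have -> : - S + 2 * S = S by ring.
have -> : \int[lebesgue_measure]_(t in `[- S, 0]) G0 t =
    \int[lebesgue_measure]_(t in `[0, S]) G0 (- t).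
  have := @Int_reflect _ G0 0 0 S lG0; rewrite sub0r subr0 => <-.
  by apply: eq_Rintegral => t _; rewrite sub0r.
rewrite addrC -RintegralD//.
- by apply: eq_Rintegral => t _; congr (_ + _); rewrite /G0; have [-> ->] := ovalN t.
- exact: lbm_integrable.
- apply: (lbm_integrable 0 S (f := fun t => G0 (- t))); apply: lbm_comp => // t.
  exact: opp_continuous.
Qed.

End Arc.

End OvalTheory.

(** * From time to the abscissa *)

Section OneJump.
Variable R : realType.
Implicit Types (f g F : R -> R) (c : R).

(** Continuity up to a jump at c. Such a jump occurs in the integrands below when
the separation line is the vertical line x = c. *)
Definition one_jump c F : Prop := exists f g : R -> R,
  [/\ continuous f, continuous g &
      forall z, F z = g z + (if 0 < z - c then f z else 0)].

Lemma one_jump_continuous c f : continuous f -> one_jump c f.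
Proof.
move=> cf; exists (fun=> 0), f; split => // [z|z]; first exact: cvg_cst.
by rewrite if_same addr0.
Qed.

Lemma one_jumpB c F (G : R -> R) : one_jump c F -> one_jump c G ->
  one_jump c (fun z => F z - G z).
Proof.
move=> [f1 [g1 [cf1 cg1 h1]]] [f2 [g2 [cf2 cg2 h2]]].
exists (fun z => f1 z - f2 z), (fun z => g1 z - g2 z); split.
- by move=> z; apply: cvgB; [exact: cf1|exact: cf2].
- by move=> z; apply: cvgB; [exact: cg1|exact: cg2].
- by move=> z; rewrite h1 h2; case: ifP => _; ring.
Qed.

Lemma one_jumpM c (q : R -> R) F : continuous q -> one_jump c F ->
  one_jump c (fun z => q z * F z).
Proof.
move=> cq [f [g [cf cg hF]]].
exists (fun z => q z * f z), (fun z => q z * g z); split.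
- by move=> z; apply: cvgM; [exact: cq|exact: cf].
- by move=> z; apply: cvgM; [exact: cq|exact: cg].
- by move=> z; rewrite hF; case: ifP => _; ring.
Qed.

Lemma one_jump_lbm c F : one_jump c F -> lbm F.
Proof.
move=> [f [g [cf cg hF]]].
have -> : F = (fun z => g z + (if 0 < z - c then f z else 0)) by apply/funext.
apply: lbmD; first exact: lbm_continuous.
apply: (lbm_if (b := fun z => z - c)).
- by apply: continuous_measurable_fun => z; apply: cvgB; [exact: cvg_id|exact: cvg_cst].
- exact: lbm_continuous.
- exact: lbm_cst.
Qed.

End OneJump.

Section Substitution.
Variables (R : realType) (p : {poly R}) (h a d S : R) (x y : R -> R).
Hypothesis ov : oval p h a d S x y.

Let sol := oval_solves ov.

Lemma oval_substitution_continuous (f : R -> R) (s1 s2 : R) : continuous f ->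
  0 <= s1 -> s1 <= s2 -> s2 <= S ->
  \int[lebesgue_measure]_(z in `[x s1, x s2]) f z =
  \int[lebesgue_measure]_(t in `[s1, s2]) (f (x t) * y t).
Proof.
move=> cf s10 s12 s2S; rewrite /Rintegral; congr fine.
have [cx cy] := solves_continuous sol.
have dx : derive1 x = y.
  by apply/funext => t; rewrite derive1E; have [[_ ->] _] := sol t.
rewrite (@integration_by_substitution_increasing R x f s1 s2)//.
- by apply: eq_integral => t _ /=; rewrite dx.
- move=> u v /[!in_itv]/= /andP[u1 _] /andP[_ v2] uv.
  by apply: (oval_x_incr ov) => //; lra.
- by rewrite dx => t _; exact: cy.
- by rewrite dx; apply: (cvgP (y s1)); apply: cvg_at_right_filter; exact: cy.
- by rewrite dx; apply: (cvgP (y s2)); apply: cvg_at_left_filter; exact: cy.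
- split.
  + by move=> t _; have [[]] := sol t.
  + by apply: cvg_at_right_filter; exact: cx.
  + by apply: cvg_at_left_filter; exact: cx.
- exact: continuous_subspaceT.
Qed.

(** On [0, S] the abscissa increases from a to d with derivative y. A jump of F
at c is met at a single time tau, where both integrals are split. *)
Lemma oval_substitution (c : R) (F : R -> R) : one_jump c F ->
  \int[lebesgue_measure]_(z in `[a, d]) F z =
  \int[lebesgue_measure]_(t in `[0, S]) (F (x t) * y t).
Proof.
move=> cutF; have lF := one_jump_lbm cutF.
case: cutF => f [g [cf cg hF]].
have [cx cy] := solves_continuous sol.
have S0 := oval_S_gt0 ov; have ad := oval_lt_ad ov.
(* Clamping c to [a, d] makes sure that it is the abscissa of some time. *)
pose k := Num.min (Num.max c a) d.
have [k1 k2] : a <= k /\ k <= d by rewrite /k le_min le_max lexx orbT ge_min lexx orbT ltW.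
have [tau /[!in_itv]/= /andP[tau0 tauS] xtau] : exists2 t, t \in `[0, S] & x t = k.
  apply: IVT; [exact: ltW|exact: continuous_subspaceT|].
  by rewrite (oval_x0 ov) (oval_xS ov) ge_min k1 le_max k2 orbT.
have below z : a <= z -> z < k -> 0 < z - c = false.
  move=> az; rewrite /k lt_min lt_max => /andP[/orP[zc|za] _]; lra.
have above z : k < z -> z <= d -> 0 < z - c.
  move=> + zd; rewrite /k gt_min gt_max => /orP[/andP[zc _]|]; lra.
have lFx : lbm (fun t => F (x t) * y t).
  by apply: lbmM; [exact: lbm_comp|exact: lbm_continuous].
have cfg : continuous (fun z => g z + f z).
  by move=> z; apply: cvgD; [exact: cg|exact: cf].
have cgx (q : R -> R) : continuous q -> lbm (fun t => q (x t) * y t).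
  move=> cq; apply: lbmM; last exact: lbm_continuous.
  by apply: lbm_comp => //; exact: lbm_continuous.
rewrite (@lbm_ItvD _ F a k d)//; last by rewrite k1 k2.
rewrite (@lbm_ItvD _ (fun t => F (x t) * y t) 0 tau S)//; last by rewrite tau0 tauS.
congr (_ + _).
- rewrite (@eq_Int_oo _ F g)//; last first.
  + by move=> z /andP[z1 z2]; rewrite hF below ?addr0// ltW.
  + exact: lbm_continuous.
  rewrite (@eq_Int_oo _ (fun t => F (x t) * y t) (fun t => g (x t) * y t))//.
  + by rewrite -(oval_x0 ov) -xtau; apply: oval_substitution_continuous.
  + exact: cgx.
  + move=> t /andP[z1 z2]; rewrite hF below ?addr0//.
      by rewrite -(oval_x0 ov); apply/ltW/(oval_x_incr ov) => //; lra.
    by rewrite -xtau; apply: (oval_x_incr ov) => //; lra.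
- rewrite (@eq_Int_oo _ F (fun z => g z + f z))//; last first.
  + by move=> z /andP[z1 z2]; rewrite hF above// ltW.
  + exact: lbm_continuous.
  rewrite (@eq_Int_oo _ (fun t => F (x t) * y t) (fun t => (g (x t) + f (x t)) * y t))//.
  + by rewrite -(oval_xS ov) -xtau; apply: (oval_substitution_continuous cfg).
  + exact: (cgx (fun z => g z + f z)).
  + move=> t /andP[z1 z2]; rewrite hF above//.
      by rewrite -xtau; apply: (oval_x_incr ov) => //; lra.
    by rewrite -(oval_xS ov); apply/ltW/(oval_x_incr ov) => //; lra.
Qed.

End Substitution.

Section SideHeight.
Variables (R : realType) (theta c : R).
Hypotheses (theta_gt0 : 0 < theta) (theta_le_pi : theta <= pi).
Local Notation L := (sepline theta c).

(** The line as a graph over the x-axis. For a vertical line this is 0, by the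
convention that the inverse of 0 is 0. *)
Definition ell (X : R) : R := sin theta / cos theta * (X - c).

Lemma on_line_ell (X Y : R) : cos theta != 0 ->
  L X Y = 0 -> ell X = Y.
Proof.
move=> c0 L0; apply: (mulfI c0); move: L0; rewrite /sepline => /subr0_eq <-.
by rewrite /ell; field.
Qed.

(** The height over the line, on the positive side only. For a line that is not
vertical this is - max (L, 0) / cos theta, which vanishes continuously on the line:
this is the purpose of subtracting ell. *)
Definition side_height (X Y : R) : R := on_side theta c (fun X Y => Y - ell X) X Y.

Lemma side_heightE X Y : cos theta != 0 ->
  side_height X Y = - (Num.max (L X Y) 0) / cos theta.
Proof.
move=> c0; rewrite /side_height /on_side.
case: ltP => _; last by rewrite oppr0 mul0r.
by rewrite /sepline /ell; field.
Qed.

Lemma sin_theta_vertical : cos theta = 0 -> sin theta = 1.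
Proof.
move=> c0; have := cos2Dsin2 theta; rewrite c0 expr0n/= add0r => /eqP.
rewrite sqrf_eq1 => /orP[/eqP//|/eqP s1].
have := sin_ge0_pi (x := theta); rewrite s1 theta_le_pi ltW// => /(_ isT); lra.
Qed.

Lemma side_height_vertical X Y : cos theta = 0 ->
  side_height X Y = if 0 < X - c then Y else 0.
Proof.
move=> c0; rewrite /side_height /on_side /sepline /ell c0 sin_theta_vertical//.
by rewrite mul0r subr0 mul1r invr0 mulr0 mul0r subr0.
Qed.

(** For a vertical line the side does not depend on Y; otherwise the positive part
is 1-Lipschitz. *)
Lemma side_height_lipschitz X Y Y' : `|side_height X Y - side_height X Y'| <= `|Y - Y'|.
Proof.
have [c0|c0] := eqVneq (cos theta) 0.
  by rewrite !side_height_vertical//; case: ifP; rewrite // subrr normr0.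
rewrite !side_heightE// -mulrBl normrM normfV ler_pdivrMr ?normr_gt0//.
rewrite -normrM.
have -> : (Y - Y') * cos theta = L X Y' - L X Y by rewrite /sepline; ring.
set u := L X Y; set v := L X Y'.
by rewrite /Num.max; case: ifPn => [|/negP/negP] u0; case: ifPn => [|/negP/negP] v0;
 rewrite -?leNgt in u0 v0; rewrite ler_norml;
 have := ler_norm (v - u); have := ler_norm (u - v); rewrite (distrC u) => ? ?;
 apply/andP; split; lra.
Qed.

Lemma side_height_one_jump (r : R -> R) : continuous r ->
  one_jump c (fun z => side_height z (r z)).
Proof.
move=> cr; have [c0|c0] := eqVneq (cos theta) 0.
  exists r, (fun=> 0); split => // [z|z]; first exact: cvg_cst.
  by rewrite side_height_vertical// add0r.
have -> : (fun z => side_height z (r z)) =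
    (fun z => - (Num.max (L z (r z)) 0) / cos theta).
  by apply/funext => z; rewrite side_heightE.
apply: one_jump_continuous => z; apply: cvgM; last exact: cvg_cst.
apply: cvgN.
have cL : continuous (fun z => L z (r z)).
  by apply: sepline_continuous => // u; exact: cvg_id.
apply: (@continuous_max _ _ (fun z => L z (r z)) (fun=> 0)); first exact: cL.
exact: cvg_cst.
Qed.

End SideHeight.

(** * The action integral as a function of the energy *)

Section Slice.
Variables (R : realType) (p : {poly R}) (theta c : R) (i : nat).
Hypotheses (theta_gt0 : 0 < theta) (theta_le_pi : theta <= pi).
Local Notation L := (sepline theta c).
Local Notation ht := (side_height theta c).
Implicit Types h z : R.

(** The value of |y| on the level h over the abscissa z. Where p > h it is 0,
because Num.sqrt vanishes on negative numbers; integrals over a fixed segment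
thus serve all energies close to h0. *)
Definition speed h z : R := Num.sqrt (2 * (h - p.[z])).
Local Notation r := speed.

(** The contribution of the two points of the oval over z. The lower one comes
with the opposite sign, as the oval is traversed to the left there. *)
Definition slice h z : R := z ^+ i * (ht z (r h z) - ht z (- r h z)).
Local Notation G := slice.

Lemma horner_cont_sub h : continuous (fun z => h - p.[z]).
Proof. by move=> z; apply: cvgB; [exact: cvg_cst|exact: continuous_horner]. Qed.

Lemma speed_continuous h : continuous (r h).
Proof.
move=> z; apply: (@continuous_comp _ _ _ (fun z => 2 * (h - p.[z])) Num.sqrt z).
  by apply: cvgM; [exact: cvg_cst|exact: horner_cont_sub].
exact: sqrt_continuous.
Qed.

Lemma slice_one_jump h : one_jump c (G h).
Proof.
apply: one_jumpM; first by move=> z; exact: exprn_continuous.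
apply: one_jumpB; apply: side_height_one_jump => //; first exact: speed_continuous.
by move=> z; apply: cvgN; exact: speed_continuous.
Qed.

Lemma slice_lbm h : lbm (G h). Proof. exact: one_jump_lbm (slice_one_jump h). Qed.

Lemma slice_out h z : h <= p.[z] -> G h z = 0.
Proof.
move=> hz; have r0 : r h z = 0 by apply: ler0_sqrtr; lra.
by rewrite /G r0 oppr0 subrr mulr0.
Qed.

Lemma slice_bound h z : `|G h z| <= `|z ^+ i| * (2 * r h z).
Proof.
rewrite normrM; apply: ler_wpM2l => //.
apply: le_trans (side_height_lipschitz _ _ _ _ _ _) _ => //.
have r0 : 0 <= r h z by exact: sqrtr_ge0.
by rewrite opprK ger0_norm; lra.
Qed.

Lemma oval_speed h a d S x y : oval p h a d S x y ->
  forall t, 0 <= t <= S -> r h (x t) = y t.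
Proof.
move=> ov t tS.
by rewrite /r -(oval_energy ov) sqrtr_sqr ger0_norm// (oval_y_ge0 ov).
Qed.

Lemma slice_Int h a d S x y : oval p h a d S x y ->
  \int[lebesgue_measure]_(t in `[0, S])
    (x t ^+ i * (ht (x t) (y t) - ht (x t) (- y t)) * y t) =
  \int[lebesgue_measure]_(z in `[a, d]) G h z.
Proof.
move=> ov; rewrite (oval_substitution ov (slice_one_jump h)).
apply: eq_Rintegral => t /[!inE]/= /[!in_itv]/= tS.
by rewrite /G (oval_speed ov).
Qed.

(** Away from the line the side is locally constant in h. *)
Lemma side_height_derive (X h0 l : R) (rho : R -> R) : is_derive h0 1 rho l ->
  L X (rho h0) != 0 ->
  is_derive h0 1 (fun h => ht X (rho h)) (if 0 < L X (rho h0) then l else 0).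
Proof.
move=> drho L0.
have cL : continuous_at h0 (fun h => L X (rho h)).
  apply: cvgB; first exact: cvg_cst.
  by apply: cvgM; [exact: cvg_cst|exact: is_derive_continuous drho].
have [Lpos|Lneg] := ltP 0 (L X (rho h0)).
- apply: (@near_eq_is_derive _ _ _ (fun h => rho h - ell theta c X)).
    have := cvgr_gt _ cL _ Lpos => /(_ _) near0; near=> h.
    by rewrite /side_height /on_side ifT//; near: h; exact: near0.
  by rewrite -[l]subr0; exact: (is_deriveB drho (is_derive_cst _ _ _)).
- have {}Lneg : L X (rho h0) < 0 by rewrite lt_neqAle L0.
  apply: (@near_eq_is_derive _ _ _ (fun=> 0)).
  have := cvgr_lt _ cL _ Lneg => /(_ _) near0; near=> h.
  rewrite /side_height /on_side ifF//; apply/negbTE; rewrite -leNgt ltW//.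
  by near: h; exact: near0.
Unshelve. all: end_near. Qed.

Lemma speed_derive (X h0 : R) : 0 < r h0 X ->
  is_derive h0 1 (fun h => r h X) (r h0 X)^-1.
Proof.
move=> r0; have pos : 0 < 2 * (h0 - p.[X]) by rewrite -sqrtr_gt0.
have d2 : is_derive h0 1 (fun h => 2 * (h - p.[X])) 2.
  by apply: is_derive_eq; rewrite /GRing.scale/= subr0 mulr1.
apply: (@is_derive_chain _ Num.sqrt (fun h => 2 * (h - p.[X])) _ _ _ _ (is_derive1_sqrt pos) d2).
by rewrite -/(r h0 X); field; rewrite gt_eqF.
Qed.

(** The factor r, which is dx / dt, cancels the singularity 1 / r of the derivative
of the square root. *)
Lemma slice_derive (X h0 : R) : 0 < r h0 X -> L X (r h0 X) != 0 ->
  L X (- r h0 X) != 0 ->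
  is_derive h0 1 (fun h => G h X * r h0 X)
    (on_side theta c (fun X _ => X ^+ i) X (r h0 X) +
     on_side theta c (fun X _ => X ^+ i) X (- r h0 X)).
Proof.
move=> r0 L1 L2; have dr := speed_derive r0.
have d1 := side_height_derive dr L1.
have d2 := @side_height_derive X h0 _ _ (is_deriveN dr) L2.
rewrite /G; apply: is_derive_eq; rewrite /on_side /GRing.scale/=.
by case: ifP => _; case: ifP => _; field; rewrite ?lt0r_neq0.
Qed.

(** With r and r0 the speeds for h and h0,
|r - r0| r0 <= |r^2 - r0^2| <= 2 |h - h0|, a bound that holds up to the turning
points. *)
Lemma slice_lipschitz (h h0 X : R) : p.[X] <= h0 ->
  `|G h X * r h0 X - G h0 X * r h0 X| <= `|X ^+ i| * 4 * `|h - h0|.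
Proof.
move=> pX; set Y := r h0 X; set rho := r h X.
have Y0 : 0 <= Y by exact: sqrtr_ge0.
have rho0 : 0 <= rho by exact: sqrtr_ge0.
have YY : Y ^+ 2 = 2 * (h0 - p.[X]) by rewrite sqr_sqrtr//; lra.
have main : `|rho - Y| * Y <= 2 * `|h - h0|.
  have hn1 := ler_norm (h - h0); have hn2 := ler_norm (h0 - h).
  rewrite distrC in hn2.
  have [hX|hX] := leP p.[X] h.
    have rr : rho ^+ 2 = 2 * (h - p.[X]) by rewrite sqr_sqrtr//; lra.
    apply: (@le_trans _ _ (`|rho - Y| * (rho + Y))).
      by apply: ler_wpM2l => //; rewrite lerDr.
    rewrite -[X in _ * X]ger0_norm ?addr_ge0// -normrM -subr_sqr YY rr.
    rewrite ler_norml; apply/andP; split; lra.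
  have -> : rho = 0 by apply: ler0_sqrtr; lra.
  by rewrite sub0r normrN ger0_norm// -expr2 YY; lra.
rewrite -mulrBl /G -mulrBr -/Y -/rho -2!mulrA normrM; apply: ler_wpM2l => //.
rewrite normrM (ger0_norm Y0).
set k1 := ht X rho; set k2 := ht X (- rho); set k3 := ht X Y; set k4 := ht X (- Y).
have -> : k1 - k2 - (k3 - k4) = (k1 - k3) - (k2 - k4) by ring.
have l1 : `|k1 - k3| <= `|rho - Y| by exact: side_height_lipschitz.
have l2 : `|k2 - k4| <= `|rho - Y|.
  apply: le_trans (side_height_lipschitz _ _ _ _ _ _) _ => //.
  by rewrite opprK addrC distrC.
apply: (@le_trans _ _ ((`|rho - Y| + `|rho - Y|) * Y)).
  apply: ler_wpM2r => //; apply: le_trans (ler_normB _ _) _; exact: lerD.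
lra.
Qed.

End Slice.

Section ActionDerivative.
Variables (R : realType) (p : {poly R}) (theta c : R) (i : nat).
Hypotheses (theta_gt0 : 0 < theta) (theta_le_pi : theta <= pi).
Local Notation L := (sepline theta c).
Local Notation G := (slice p theta c i).

(** The integral of x^i (y - ell(x)) dx over the arc, folded onto [0, S]. *)
Definition action (S : R) (x y : R -> R) : R :=
  \int[lebesgue_measure]_(t in `[0, S])
    (x t ^+ i * (side_height theta c (x t) (y t) - side_height theta c (x t) (- y t)) * y t).

(** The integral of x^i dt over the arc, folded onto [0, S]. *)
Definition side_time (S : R) (x y : R -> R) : R :=
  \int[lebesgue_measure]_(t in `[0, S])
    (on_side theta c (fun X _ => X ^+ i) (x t) (y t) +
     on_side theta c (fun X _ => X ^+ i) (x t) (- y t)).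

(** On the orbit y^2 = 2 (h - p(x)). At a point on the line y = ell(x), hence
ell^2 - 2 (h - p) vanishes there; this polynomial is not 0, being positive just to
the right of d. A vertical line is met only over the root c of 'X - c. *)
Lemma line_crossing_poly (h d : R) : p.[d] = h -> 0 < p^`().[d] ->
  exists2 q : {poly R}, q != 0 &
    forall X Y, Y ^+ 2 = 2 * (h - p.[X]) -> L X Y = 0 -> root q X.
Proof.
move=> pd sd; have [c0|c0] := eqVneq (cos theta) 0.
  exists ('X - c%:P); first by rewrite polyXsubC_eq0.
  move=> X Y _; rewrite /sepline c0 (sin_theta_vertical theta_gt0 theta_le_pi c0).
  by rewrite mul0r subr0 mul1r root_XsubC => /subr0_eq ->.
pose q := (sin theta / cos theta) ^+ 2 *: ('X - c%:P) ^+ 2 - 2 *: (h%:P - p).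
have qE X : q.[X] = (sin theta / cos theta * (X - c)) ^+ 2 - 2 * (h - p.[X]).
  by rewrite /q !hornerE/=; set k := sin theta / cos theta; ring.
exists q.
  have [e e0 [hr _]] := is_derive_gt0_local (is_derive_poly p d) sd.
  have := hr (d + e / 2); rewrite pd => /(_ ltac:(apply/andP; split; lra)) gt.
  apply: contraTneq (ltr0n R 1) => q0; exfalso.
  have := qE (d + e / 2); rewrite q0 horner0.
  have := sqr_ge0 (sin theta / cos theta * (d + e / 2 - c)); lra.
move=> X Y YY L0; rewrite /root qE -YY.
by rewrite -(on_line_ell c0 L0) /ell subrr.
Qed.

Lemma oval_preimage_finite h a d S x y (B : set R) : oval p h a d S x y ->
  finite_set B -> finite_set (`[0, S]%classic `&` x @^-1` B).
Proof.
move=> ov finB; set A := _ `&` _.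
have injx : {in A &, injective x}.
  move=> s t /set_mem[/= /[!in_itv]/= /andP[s0 sS] _] /set_mem[/= /[!in_itv]/= /andP[t0 tS] _] xst.
  have [st|ts|//] := ltgtP s t.
    by have := oval_x_incr ov s0 st tS; rewrite xst ltxx.
  by have := oval_x_incr ov t0 ts sS; rewrite xst ltxx.
apply/(card_le_finite (B := x @` A)); last first.
  by apply: sub_finite_set finB => _ [t [_ Bt] <-].
by have := inj_card_eq injx; rewrite card_eq_le => /andP[].
Qed.

(** The action is the integral of the slice over a segment [A, D] around [a0, d0].
Over [a0, d0] the variable is changed back to the time of the oval of energy h0,
and the derivative is taken under the integral sign; the times to be excluded are
those of the turning points and of the crossings of the line. The remaining two
pieces of [A, D] have derivative 0 at h0. *)
Lemma action_derive (N : R -> R) (h0 a0 d0 S0 : R) (x0 y0 : R -> R) :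
  oval p h0 a0 d0 S0 x0 y0 ->
  (forall e : R, 0 < e -> \forall h \near h0, exists a d S x y,
    [/\ oval p h a d S x y, `|a - a0| < e, `|d - d0| < e & N h = action S x y]) ->
  is_derive h0 1 N (side_time S0 x0 y0).
Proof.
move=> ov0 hN.
have [cx cy] := solves_continuous (oval_solves ov0).
have oval_pa h a d S x y : oval p h a d S x y -> p.[a] = h.
  move=> ov; have := oval_energy ov 0; rewrite (oval_x0 ov) (oval_y0 ov) expr0n/=; lra.
have oval_pd h a d S x y : oval p h a d S x y -> p.[d] = h.
  move=> ov; have := oval_energy ov S; rewrite (oval_xS ov) (oval_yS ov) expr0n/=; lra.
have pa0 := oval_pa _ _ _ _ _ _ ov0; have pd0 := oval_pd _ _ _ _ _ _ ov0.
have ad0 := oval_lt_ad ov0.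
have [da [ka [da0 ka0 growa]]] : exists del k : R, [/\ 0 < del, 0 < k &
    forall z w, `|z - a0| <= del -> `|w - a0| <= del -> z <= w ->
      k * (w - z) <= p.[z] - p.[w]].
  have [|del [k [del0 k0 H]]] := @slope_window R (- p) a0.
    by rewrite derivN hornerN oppr_gt0 (oval_slope_a ov0).
  exists del, k; split => // z w z1 w1 zw; have := H z w z1 w1 zw.
  by rewrite !hornerN; lra.
have [dd [kd [dd0 kd0 growd]]] := slope_window (oval_slope_d ov0).
pose A := a0 - da; pose D := d0 + dd.
have [C hC] := (lbm_continuous (@exprn_continuous R i)).2 A D.
have CD0 : 0 <= C by apply: le_trans (hC a0 _) => //; rewrite /A /D; apply/andP; split; lra.
have lG h := slice_lbm p c i theta_gt0 theta_le_pi h.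
pose Nx h := \int[lebesgue_measure]_(z in `[A, D]) G h z.
(* As p is monotone next to a0 and d0, it exceeds h on the parts of [A, D]
   outside the oval, and the slice is 0 there. *)
have NE : \forall h \near h0, Nx h = N h.
  have m0 : 0 < Num.min da dd by rewrite lt_min da0 dd0.
  near=> h.
  have [a [d [S [x [y [ov ea ed ->]]]]]] : exists a d S x y,
      [/\ oval p h a d S x y, `|a - a0| < Num.min da dd, `|d - d0| < Num.min da dd &
          N h = action S x y].
    by near: h; exact: hN.
  move: ea ed; rewrite !lt_min => /andP[ea _] /andP[_ ed].
  have /ler_normlP[ea1 ea2] := ltW ea; have /ler_normlP[ed1 ed2] := ltW ed.
  have pa := oval_pa _ _ _ _ _ _ ov; have pd := oval_pd _ _ _ _ _ _ ov.
  have ad := oval_lt_ad ov.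
  rewrite /action (@slice_Int _ p theta c i theta_gt0 theta_le_pi h a d S x y ov)// /Nx.
  rewrite (@lbm_ItvD _ (G h) A a D)//; last by rewrite /A /D; apply/andP; split; lra.
  rewrite (@lbm_ItvD _ (G h) a d D)//; last by rewrite /D; apply/andP; split; lra.
  have -> : \int[lebesgue_measure]_(z in `[A, a]) G h z = 0.
    rewrite -(Int0 A a); apply: eq_Int_oo => //; first exact: lbm_cst.
    move=> z /andP[z1 z2]; apply: slice_out; rewrite -pa.
    have := growa z a _ (ltW ea) (ltW z2).
    have : 0 <= ka * (a - z) by apply: mulr_ge0; lra.
    move=> k1 k2; suff : `|z - a0| <= da by move/k2; lra.
    by apply/ler_normlP; move: z1; rewrite /A => z1; split; lra.
  have -> : \int[lebesgue_measure]_(z in `[d, D]) G h z = 0.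
    rewrite -(Int0 d D); apply: eq_Int_oo => //; first exact: lbm_cst.
    move=> z /andP[z1 z2]; apply: slice_out; rewrite -pd.
    have := growd d z (ltW ed) _ (ltW z1).
    have : 0 <= kd * (z - d) by apply: mulr_ge0; lra.
    move=> k1 k2; suff : `|z - d0| <= dd by move/k2; lra.
    by apply/ler_normlP; move: z2; rewrite /D => z2; split; lra.
  by rewrite add0r addr0.
apply: (near_eq_is_derive NE).
pose El h := \int[lebesgue_measure]_(z in `[A, a0]) G h z.
pose Er h := \int[lebesgue_measure]_(z in `[d0, D]) G h z.
pose Em h := \int[lebesgue_measure]_(t in `[0, S0]) (G h (x0 t) * y0 t).
have -> : Nx = (fun h => El h + (Em h + Er h)).
  apply/funext => h; rewrite /Nx /El /Em /Er.
  rewrite -(oval_substitution ov0 (slice_one_jump p c i theta_gt0 theta_le_pi h)).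
  rewrite (@lbm_ItvD _ (G h) A a0 D)//; last by rewrite /A /D; apply/andP; split; lra.
  by rewrite (@lbm_ItvD _ (G h) a0 d0 D)// /D; apply/andP; split; lra.
(* Next to a turning point w the slice at h0 + k has height O(sqrt |k|) and
   width |k| / kk. *)
have edge u v w kk : u <= v -> w = u \/ w = v -> 0 < kk -> A <= u -> v <= D ->
    (forall z, u <= z <= v -> h0 + kk * `|z - w| <= p.[z]) ->
    is_derive h0 1 (fun h => \int[lebesgue_measure]_(z in `[u, v]) G h z) 0.
  move=> uv wuv kk0 Au vD far.
  apply: (@is_derive0_growth _ _ _ (C * (2 * Num.sqrt 2) / kk)); near=> k.
  have -> : \int[lebesgue_measure]_(z in `[u, v]) G h0 z = 0.
    rewrite -(Int0 u v); apply: eq_Int_oo => //; first exact: lbm_cst.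
    move=> z /andP[z1 z2]; apply: slice_out.
    have := far z; rewrite (ltW z1) (ltW z2) => /(_ isT).
    have : 0 <= kk * `|z - w| by rewrite mulr_ge0// ltW.
    by lra.
  rewrite subr0.
  have -> : C * (2 * Num.sqrt 2) / kk * `|k| * Num.sqrt `|k| =
      (C * (2 * Num.sqrt (2 * `|k|))) * (`|k| / kk).
    by rewrite sqrtrM//; field; rewrite ?lt0r_neq0.
  apply: (Int_edge (lG (h0 + k)) uv wuv).
  - by rewrite divr_ge0// ltW.
  - by rewrite mulr_ge0// mulr_ge0// sqrtr_ge0.
  - move=> z zuv; have /andP[z1 z2] := zuv.
    apply: le_trans (slice_bound _ _ _ _ _ _ _) _ => //.
    apply: ler_pM => //; first by rewrite mulr_ge0// sqrtr_ge0.
      by apply: hC; rewrite (le_trans Au z1) (le_trans z2 vD).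
    rewrite ler_pM2l//; apply: ler_wsqrtr.
    have := far z zuv; have : 0 <= kk * `|z - w| by rewrite mulr_ge0// ltW.
    have := ler_norm k; lra.
  - move=> z zuv; rewrite ler_pdivrMr// mulrC => far'; apply: slice_out.
    by have := far z zuv; have := ler_norm k; lra.
have dEl : is_derive h0 1 El 0.
  apply: (edge A a0 a0 ka) => //.
  - by rewrite /A; lra.
  - by right.
  - by rewrite /D; lra.
  - move=> z /andP[z1 z2].
    have zz : `|z - a0| <= da.
      by apply/ler_normlP; move: z1; rewrite /A => z1; split; lra.
    have aa : `|a0 - a0| <= da by rewrite subrr normr0 ltW.
    have := growa z a0 zz aa z2.
    by rewrite distrC ger0_norm ?subr_ge0//; lra.
have dEr : is_derive h0 1 Er 0.
  apply: (edge d0 D d0 kd) => //.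
  - by rewrite /D; lra.
  - by left.
  - by rewrite /A; lra.
  - move=> z /andP[z1 z2].
    have zz : `|z - d0| <= dd.
      by apply/ler_normlP; move: z2; rewrite /D => z2; split; lra.
    have aa : `|d0 - d0| <= dd by rewrite subrr normr0 ltW.
    have := growd d0 z aa zz z1.
    by rewrite ger0_norm ?subr_ge0//; lra.
have dEm : is_derive h0 1 Em (side_time S0 x0 y0).
  have [q q0 crossing] := line_crossing_poly pd0 (oval_slope_d ov0).
  pose B := [set z | root q z] `|` [set a0; d0].
  have finB : finite_set B.
    by rewrite /B !finite_setU; split; [exact: finite_roots|split; exact: finite_set1].
  apply: (@derive_under_Int _ (fun h t => G h (x0 t) * y0 t) _ h0 0 S0 (C * 4) _ _ _
    (oval_preimage_finite ov0 finB)).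
  - move=> h; apply: lbmM; last exact: lbm_continuous.
    by apply: lbm_comp.
  - have lpow : lbm (fun t => x0 t ^+ i).
      apply: (lbm_comp (f := fun z => z ^+ i)) => //.
      by apply: lbm_continuous; exact: exprn_continuous.
    apply: lbmD; apply: lbm_on_side => //.
    by move=> t; apply: cvgN; exact: cy.
  - move=> h t tS; rewrite -(oval_speed ov0 tS).
    apply: le_trans (slice_lipschitz _ _ _ _ _ _) _ => //.
      by have := oval_energy ov0 t; have := sqr_ge0 (y0 t); lra.
    apply: ler_wpM2r => //; apply: ler_wpM2r => //; apply: hC.
    move: tS => /andP[t0 tS].
    have xa : a0 <= x0 t.
      move: t0; rewrite le_eqVlt => /predU1P[<-|t0]; first by rewrite (oval_x0 ov0).
      by rewrite -(oval_x0 ov0) ltW// (oval_x_incr ov0).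
    have xd : x0 t <= d0.
      move: tS; rewrite le_eqVlt => /predU1P[->|tS]; first by rewrite (oval_xS ov0).
      by rewrite -(oval_xS ov0) ltW// (oval_x_incr ov0).
    by rewrite /A /D; apply/andP; split; lra.
  - move=> t tS nZ; rewrite -(oval_speed ov0 tS).
    have nB : ~ B (x0 t) by move=> Bt; apply: nZ; split => //=; rewrite in_itv.
    have en := oval_energy ov0 t.
    have [t0 tS'] := andP tS.
    have yt : 0 < y0 t.
      apply: (oval_y_gt0 ov0); rewrite !lt_neqAle t0 tS' !andbT; apply/andP; split.
        by apply/eqP => t00; apply: nB; right; left; rewrite -t00 (oval_x0 ov0).
      by apply/eqP => t00; apply: nB; right; right; rewrite t00 (oval_xS ov0).
    apply: slice_derive; rewrite ?(oval_speed ov0 tS)//.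
      by apply/eqP => L0; apply: nB; left; exact: crossing en L0.
    apply/eqP => L0; apply: nB; left; apply: crossing L0; by rewrite sqrrN.
by apply: is_derive_eq; rewrite add0r addr0.
Unshelve. all: end_near. Qed.

End ActionDerivative.

(** * Matrix form of the moment relations *)

(** The matrix is triangular with diagonal entries (n + 2 r) b_n. *)
Lemma T4_unit (R : realType) (n : nat) (b : nat -> R) : (0 < n)%N -> b n != 0 ->
  T4 n b \in unitmx.
Proof.
move=> n0 bn; rewrite unitmxE det_trig; last first.
  apply/is_trig_mxP => i j ij; rewrite mxE leqNgt ij//.
rewrite unitfE; apply/prodf_neq0 => i _; rewrite mxE leqnn addnK.
rewrite mulf_neq0// pnatr_eq0 -lt0n addn_gt0 addn_gt0 n0//.
Qed.

Lemma window_sum (V : zmodType) (M lo n : nat) (F : nat -> V) : (lo + n <= M)%N ->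
  \sum_(m < M) (if (lo <= m < lo + n)%N then F m else 0) =
  \sum_(k < n) F (lo + k)%N.
Proof.
move=> le; rewrite -(big_mkord xpredT (fun m => if (lo <= m < lo + n)%N then F m else 0)).
rewrite (@big_cat_nat _ _ _ lo) ?leq0n//=; last exact: leq_trans (leq_addr _ _) le.
rewrite [X in _ + X](@big_cat_nat _ _ _ (lo + n)) ?leq_addr//=.
rewrite big1_seq ?add0r; last first.
  by move=> m /=; rewrite mem_index_iota => /andP[_ lt]; rewrite leqNgt lt.
rewrite [X in _ + X]big1_seq ?addr0; last first.
  by move=> m /=; rewrite mem_index_iota => /andP[lt _]; rewrite [(m < _)%N]ltnNge lt andbF.
rewrite -{1}[lo]add0n big_addn addKn big_mkord; apply: eq_bigr => k _.
by rewrite leq_addl (addnC k) ltn_add2l ltn_ord.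
Qed.

Section Algebra.
Variables (R : realType) (n : nat) (b A : nat -> R) (h : R).
Hypothesis n_gt1 : (1 < n)%N.

Let n1 : n.-1.+1 = n. Proof. by rewrite prednK// ltnW. Qed.

Lemma split_window (c : nat -> R) :
  \sum_(s < n.-1) c s + \sum_(s < n) c (n.-1 + s)%N = \sum_(m < n.-1 + n) c m.
Proof. by rewrite big_split_ord. Qed.

(** Side by side, T1 acting on the moments 0, ..., n - 2 and - T2 acting on the
moments n - 1, ..., 2 n - 2 have in row r the coefficients of a window of moments
from r to r + n. *)
Lemma T12_row (r : 'I_n.-1) :
  \sum_s T1 n b h r s * A s - \sum_s T2 n b r s * A (n.-1 + s)%N =
  h * A r - \sum_(k < n) b k.+1 * A (r + k.+1)%N.
Proof.
have rn := ltn_ord r.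
pose c m := if (r.+1 <= m < r.+1 + n)%N then b (m - r)%N * A m else 0.
have -> : \sum_(k < n) b k.+1 * A (r + k.+1)%N = \sum_(m < n.-1 + n) c m.
  rewrite /c (@window_sum _ _ _ _ (fun m => b (m - r)%N * A m)).
    by apply: eq_bigr => k _; rewrite addSnnS addKn.
  by rewrite leq_add2r.
rewrite -(split_window c) opprD addrA; congr (_ - _).
  rewrite (bigD1 r)//= [in RHS](bigD1 r)//= mxE eqxx.
  rewrite [c r]/c ltnn add0r -sumrN; congr (_ + _); apply: eq_bigr => s sr.
  rewrite mxE (negbTE sr : (s == r :> nat) = false) /c.
  have -> : (s < r.+1 + n)%N.
    by rewrite (leq_trans (ltn_ord s))// (leq_trans (leq_pred n))// leq_addl.
  by case: ifP => _; rewrite ?mul0r ?oppr0 ?mulNr.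
apply: eq_bigr => s _; rewrite mxE /c.
have -> : (r < n.-1 + s)%N by rewrite (leq_trans rn)// leq_addr.
have -> : (n.-1 + s < r.+1 + n)%N = (s <= r.+1)%N.
  by have := n_gt1; lia.
by case: ifP => _ /=; rewrite ?mul0r.
Qed.

(** As in [T12_row], with the window of moments from r to r + n - 1 and one more
entry to its left, coming from the subdiagonal of T3. *)
Lemma T34_row (r : 'I_n) :
  \sum_s T3 n b h r s * A s + \sum_s T4 n b r s * A (n.-1 + s)%N =
  \sum_(k < n) (2 * r + k.+1)%N%:R * b k.+1 * A (r + k)%N - 2 * r%:R * h * A r.-1.
Proof.
have rn : (r <= n.-1)%N by rewrite -ltnS n1.
pose c m := if (r <= m < r + n)%N then (r + m + 1)%N%:R * b (m - r + 1)%N * A m else 0.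
have -> : \sum_(k < n) (2 * r + k.+1)%N%:R * b k.+1 * A (r + k)%N =
    \sum_(m < n.-1 + n) c m.
  rewrite /c (@window_sum _ _ _ _ (fun m => (r + m + 1)%N%:R * b (m - r + 1)%N * A m)).
    by apply: eq_bigr => k _; rewrite addKn addn1 addnA addnn -mul2n addn1 addnS.
  by rewrite leq_add2r.
rewrite -(split_window c) addrAC; congr (_ + _); last first.
  apply: eq_bigr => s _; rewrite mxE /c.
  have -> : (r <= n.-1 + s)%N by rewrite (leq_trans rn)// leq_addr.
  have -> : (n.-1 + s < r + n)%N = (s <= r)%N.
    by have := n_gt1; lia.
  case: ifP => sr; rewrite /= ?mul0r//; congr (_%:R * b _ * _).
    by have := n_gt1; lia.
  by have := n_gt1; lia.
have -> : 2 * r%:R * h * A r.-1 =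
    \sum_(s < n.-1) (if s.+1 == r :> nat then 2 * r%:R * h * A s else 0).
  case: (posnP r) => [r0|r_gt0].
    by rewrite r0 mulr0 !mul0r big1// => s _; case: ifP => // /eqP.
  have lt : (r.-1 < n.-1)%N by rewrite -ltnS !prednK// ltnW.
  rewrite (bigD1 (Ordinal lt))//= prednK// eqxx big1 ?addr0// => s.
  rewrite -val_eqE/= => sr; case: ifP => // /eqP sE; move: sr.
  by rewrite -sE/= eqxx.
rewrite -sumrB; apply: eq_bigr => s _; rewrite mxE /c.
have -> : (s < r + n)%N.
  by rewrite (leq_trans (ltn_ord s))// (leq_trans (leq_pred n))// leq_addl.
rewrite andbT; case: leqP => rs.
  by rewrite (gtn_eqF (_ : r < s.+1)%N)// subr0.
by case: ifP => _; rewrite sub0r ?mulNr ?mul0r ?oppr0.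
Qed.

(** With B the opposite of the moments n - 1, ..., 2 n - 2, the hypotheses say
X = 2 T1 A + 2 T2 B and T4 B = T3 A + K; it remains to eliminate B. *)
Lemma picard_fuchs_algebra (X K : nat -> R) : b n != 0 ->
  (forall i, X i = 2 * h * A i - 2 * \sum_(k < n) b k.+1 * A (i + k.+1)%N) ->
  (forall i, K i = 2 * i%:R * h * A i.-1 -
     \sum_(k < n) (2 * i + k.+1)%N%:R * b k.+1 * A (i + k)%N) ->
  2 *: ((T1 n b h + T2 n b *m invmx (T4 n b) *m T3 n b h) *m (\col_i A i))
      + 2 *: (T2 n b *m invmx (T4 n b) *m (\col_i K i)) =
  \col_i X i.
Proof.
move=> bn XE KE; have U := T4_unit (ltnW n_gt1) bn.
pose B : 'cV[R]_n := \col_s - A (n.-1 + s)%N.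
have BE : T4 n b *m B = T3 n b h *m (\col_i A i) + \col_i K i.
  apply/matrixP => r j; rewrite !mxE KE.
  under eq_bigr do rewrite [B _ _]mxE mulrN.
  rewrite sumrN; under [in RHS]eq_bigr do rewrite [(\col_i A i) _ _]mxE.
  by have := T34_row r; lra.
have BV : invmx (T4 n b) *m (T3 n b h *m (\col_i A i) + \col_i K i) = B.
  by rewrite -BE mulKmx.
rewrite mulmxDl -scalerDr -!addrA -!mulmxA -!mulmxDr BV.
apply/matrixP => r j; rewrite !mxE XE.
under eq_bigr do rewrite [(\col_i A i) _ _]mxE.
under [X in _ * (_ + X)]eq_bigr do rewrite [B _ _]mxE mulrN.
by rewrite sumrN; have := T12_row r; lra.
Qed.

End Algebra.

(** * Moments of an arc *)

Section Moments.
Variables (R : realType) (n : nat) (b : nat -> R).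

Definition potential : {poly R} := \sum_(k < n) b k.+1 *: 'X^(k.+1).

Lemma potentialE z : potential.[z] = \sum_(k < n) b k.+1 * z ^+ k.+1.
Proof. by rewrite horner_sum; apply: eq_bigr => k _; rewrite !hornerE. Qed.

Lemma deriv_potentialE z :
  potential^`().[z] = \sum_(k < n) k.+1%:R * b k.+1 * z ^+ k.
Proof.
rewrite /potential raddf_sum horner_sum; apply: eq_bigr => k _.
by rewrite /= derivZ derivXn hornerZ hornerMn hornerXn/= -mulr_natl; ring.
Qed.

Lemma hamiltonianE x y : hamiltonian n b x y = 2^-1 * y ^+ 2 + potential.[x].
Proof. by rewrite /hamiltonian potentialE big_add1 big_mkord. Qed.

Lemma is_solution_solves (phi : R -> R * R) : is_solution (hamiltonian n b) phi ->
  solves potential (fun t => (phi t).1) (fun t => (phi t).2).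
Proof.
move=> sol t; have [h1 h2] := sol t; split.
- apply: is_derive_eq h1 _.
  under [X in derive1 X]eq_fun do rewrite hamiltonianE.
  rewrite derive1E; set Y := (phi t).2; set k := potential.[_].
  have dy : is_derive Y 1 (fun y : R => 2^-1 * y ^+ 2 + k) Y.
    by apply: is_derive_eq; rewrite /GRing.scale/= ?addr0 ?expr1; field.
  exact: (@derive_val _ _ _ _ _ _ _ dy).
- apply: is_derive_eq h2 _; congr (- _).
  under [X in derive1 X]eq_fun do rewrite hamiltonianE.
  rewrite derive1E; set X := (phi t).1; set k := _ * _.
  have dx : is_derive X 1 (fun x : R => k + potential.[x]) (potential^`().[X]).
    rewrite -[potential^`().[X]]add0r.
    exact: (is_deriveD (is_derive_cst k X 1) (is_derive_poly potential X)).
  exact: (@derive_val _ _ _ _ _ _ _ dx).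
Qed.

Variables (h t1 t2 : R) (phi : R -> R * R).
Hypothesis sol : solves potential (fun t => (phi t).1) (fun t => (phi t).2).
Hypothesis energy : forall t, (phi t).2 ^+ 2 = 2 * (h - potential.[(phi t).1]).
Local Notation u := (fun t => (phi t).1).
Local Notation v := (fun t => (phi t).2).

Definition moment (j : nat) : R :=
  \int[lebesgue_measure]_(t in `[t1, t2]) ((phi t).1 ^+ j).

Lemma moment_lbm j : lbm (fun t => (phi t).1 ^+ j).
Proof.
apply: (lbm_comp (f := fun z : R => z ^+ j) (g := u)).
  by apply: lbm_continuous; exact: exprn_continuous.
by have [] := solves_continuous sol.
Qed.

Lemma Int_combination (a0 : R) (j0 : nat) (a : 'I_n -> R) (j : 'I_n -> nat) :
  \int[lebesgue_measure]_(t in `[t1, t2])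
    (a0 * (phi t).1 ^+ j0 - \sum_(k < n) a k * (phi t).1 ^+ j k) =
  a0 * moment j0 - \sum_(k < n) a k * moment (j k).
Proof.
have lz (c : R) m : lbm (fun t => c * (phi t).1 ^+ m).
  by apply: lbmM; [exact: lbm_cst|exact: moment_lbm].
have [ls E] := @Int_sum R t1 t2 _ (index_enum 'I_n) (fun k t => a k * (phi t).1 ^+ j k)
  (fun k => lz _ _).
have Zl (c : R) m : \int[lebesgue_measure]_(t in `[t1, t2]) (c * (phi t).1 ^+ m) =
    c * moment m.
  by rewrite RintegralZl//; apply: lbm_integrable; exact: moment_lbm.
rewrite RintegralB//; try exact: lbm_integrable.
  by rewrite E Zl; congr (_ - _); apply: eq_bigr => k _; exact: Zl.
Qed.

Lemma derive1_orbit : derive1 u = v.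
Proof. by apply/funext => t; rewrite derive1E; have [[_ ->] _] := sol t. Qed.

(** Along the flow x^i y dx = x^i y^2 dt, and y^2 = 2 (h - p(x)). *)
Lemma arcI_moments i : arcI phi t1 t2 i 1 =
  2 * h * moment i - 2 * \sum_(k < n) b k.+1 * moment (i + k.+1)%N.
Proof.
rewrite /arcI /line_integral derive1_orbit mulr_sumr.
under [in RHS]eq_bigr do rewrite mulrA.
rewrite -(Int_combination (2 * h) i (fun k => 2 * b k.+1) (fun k => (i + k.+1)%N)).
apply: eq_Rintegral => t _; rewrite expr1 -mulrA -expr2 energy potentialE.
rewrite mulrBr mulrBr; congr (_ - _); first by ring.
rewrite mulrCA 2!mulr_sumr; apply: eq_bigr => k _; rewrite exprD; ring.
Qed.

(** Along the flow d(x^i y) = (i x^(i-1) y^2 - x^i p'(x)) dt, and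
y^2 = 2 (h - p(x)). For i = 0 the index i.-1 is harmless, its coefficient being 0. *)
Lemma arcK_moments i : arcK phi t1 t2 i 1 =
  2 * i%:R * h * moment i.-1 -
  \sum_(k < n) (2 * i + k.+1)%N%:R * b k.+1 * moment (i + k)%N.
Proof.
rewrite /arcK /line_integral.
rewrite -(Int_combination _ _ (fun k => (2 * i + k.+1)%N%:R * b k.+1) (fun k => (i + k)%N)).
apply: eq_Rintegral => t _; rewrite mul1r derive1E.
have du : is_derive t 1 (fun s => (phi s).1) (phi t).2 := (sol t).1.
have dv : is_derive t 1 (fun s => (phi s).2) (- potential^`().[(phi t).1]) :=
  (sol t).2.
have d : is_derive t 1 (fun s => (phi s).1 ^+ i * (phi s).2 ^+ 1)
   (i%:R * (phi t).1 ^+ i.-1 * (phi t).2 ^+ 2 - (phi t).1 ^+ i * potential^`().[(phi t).1]).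
  have dX := is_derive_chain (is_derive_exprn i (phi t).1) du erefl.
  have -> : (fun s => (phi s).1 ^+ i * (phi s).2 ^+ 1) =
      (fun s => (phi s).1 ^+ i * (phi s).2) by apply/funext => s; rewrite expr1.
  apply: (is_derive_eq (is_deriveM dX dv)); rewrite /GRing.scale/=; ring.
rewrite (@derive_val _ _ _ _ _ _ _ d) energy potentialE deriv_potentialE.
rewrite mulrBr mulrBr -addrA; congr (_ + _); first by ring.
rewrite -opprD; congr (- _); rewrite 2!mulr_sumr mulr_sumr -big_split/=.
apply: eq_bigr => k _; rewrite natrD natrM exprD.
case: (i) => [|i'] /=; first by rewrite expr0; ring.
by rewrite !exprS; ring.
Qed.

End Moments.

(** * The period annulus *)

Lemma oval_range (R : realType) (p : {poly R}) (h a d S : R) (x y : R -> R) :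
  oval p h a d S x y -> forall t, a <= x t <= d.
Proof.
move=> ov t; have S0 := oval_S_gt0 ov.
have half s : 0 <= s <= S -> a <= x s <= d.
  move=> /andP[s0 sS]; apply/andP; split.
    move: s0; rewrite le_eqVlt => /predU1P[<-|s0]; first by rewrite (oval_x0 ov).
    by rewrite -(oval_x0 ov) ltW// (oval_x_incr ov).
  move: sS; rewrite le_eqVlt => /predU1P[->|sS]; first by rewrite (oval_xS ov).
  by rewrite -(oval_xS ov) ltW// (oval_x_incr ov).
have S20 : 0 < 2 * S by rewrite mulr_gt0.
have [r /andP[r0 rS] [-> _]] := periodic_reduce S20
  (fun t => (oval_periodic ov t).1) (fun t => (oval_periodic ov t).2) t.
have [rS'|Sr] := leP r S; first by apply: half; rewrite r0.
have -> : r = S + (r - S) by ring.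
by rewrite (oval_reflect ov (r - S)).1; apply: half; apply/andP; split; lra.
Qed.

Lemma oval_of_orbit (R : realType) (n : nat) (b : nat -> R) (h : R) (G : set (R * R)) :
  periodic_orbit (hamiltonian n b) G ->
  G `<=` [set p | hamiltonian n b p.1 p.2 = h] ->
  exists a d S x y, oval (potential n b) h a d S x y /\
    G = range (fun t => (x t, y t)).
Proof.
move=> [phi [T [sol T0 per [t0 nc] GE]]] lvl.
have en t : (phi t).2 ^+ 2 = 2 * (h - (potential n b).[(phi t).1]).
  have := lvl (phi t); rewrite GE => /(_ (ex_intro2 _ _ t I erefl)) /=.
  by rewrite hamiltonianE => <-; field.
have [||||a [d [S [s ov]]]] := @oval_of_periodic R _ h T _ _ (is_solution_solves sol) T0.
- by move=> t; rewrite per.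
- by move=> t; rewrite per.
- by exists t0; rewrite -!surjective_pairing.
- exact: en.
exists a, d, S, (fun t => (phi (s + t)).1), (fun t => (phi (s + t)).2); split => //.
rewrite GE; apply/seteqP; split=> q [t _ <-].
  by exists (t - s) => //; rewrite -surjective_pairing addrC subrK.
by exists (s + t) => //; rewrite -surjective_pairing.
Qed.

Lemma near_energy_interval (R : realType) (alpha beta : \bar R) (h0 : R) :
  energy_interval alpha beta h0 -> \forall h \near h0, energy_interval alpha beta h.
Proof.
move=> [ha hb].
have na : \forall h \near h0, (alpha < h%:E)%E.
  case: alpha ha => [al| |] //; last by move=> _; near=> h; exact: ltNyr.
  by rewrite lte_fin => ha; near=> h; rewrite lte_fin; near: h; exact: lt_nbhsr.
have nb : \forall h \near h0, (h%:E < beta)%E.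
  case: beta hb => [be| |] //; first last.
    by move=> _; near=> h; exact: ltry.
  by rewrite lte_fin => hb; near=> h; rewrite lte_fin; near: h; exact: lt_nbhsl.
by near=> h; split; near: h.
Unshelve. all: end_near. Qed.

(** The turning points are the extreme abscissae of the orbit, and these move by
less than e when the orbit stays within Hausdorff distance e. *)
Lemma oval_ends_continuous (R : realType) (p : {poly R}) (Gamma : R -> set (R * R))
    (h0 a0 d0 S0 : R) (x0 y0 : R -> R) (e : R) :
  hausdorff_continuous_at Gamma h0 ->
  oval p h0 a0 d0 S0 x0 y0 -> Gamma h0 = range (fun t => (x0 t, y0 t)) ->
  0 < e ->
  \forall h \near h0, forall a d S x y, oval p h a d S x y ->
    Gamma h = range (fun t => (x t, y t)) -> `|a - a0| < e /\ `|d - d0| < e.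
Proof.
move=> hc ov0 G0 e0; apply: (filterS _ (hc e e0)) => h [far near_] a d S x y ov GE.
have up q t' : ball q e (x t', y t') -> `|q.1 - x t'| < e by case.
have range0 := oval_range ov0; have range := oval_range ov.
have inG t : Gamma h (x t, y t) by rewrite GE; exists t.
have inG0 t : Gamma h0 (x0 t, y0 t) by rewrite G0; exists t.
have clos t : exists s, `|x0 s - x t| < e.
  by have [q] := far _ (inG t); rewrite G0 => -[s _ <-] /up; exists s.
have clos0 t : exists s, `|x0 t - x s| < e.
  have [q] := near_ _ (inG0 t); rewrite GE => -[s _ <-] [/= bx _]; exists s.
  by rewrite distrC.
have bnd u v : `|u - v| < e -> u - v < e /\ v - u < e.
  by rewrite ltr_norml => /andP[? ?]; split; lra.
split.
- have [s1 /bnd[l1 l2]] := clos 0; have [s2 /bnd[l3 l4]] := clos0 0.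
  rewrite (oval_x0 ov) in l1 l2; rewrite (oval_x0 ov0) in l3 l4.
  have /andP[r1 _] := range0 s1; have /andP[r2 _] := range s2.
  by rewrite ltr_norml; apply/andP; split; lra.
- have [s1 /bnd[l1 l2]] := clos S; have [s2 /bnd[l3 l4]] := clos0 S0.
  rewrite (oval_xS ov) in l1 l2; rewrite (oval_xS ov0) in l3 l4.
  have /andP[_ r1] := range0 s1; have /andP[_ r2] := range s2.
  by rewrite ltr_norml; apply/andP; split; lra.
Qed.

(** * Abelian integrals along an arc *)

(** A primitive of z^i ell(z). *)
Definition chord_poly (R : realType) (theta c : R) (i : nat) : {poly R} :=
  (sin theta / cos theta) *:
    ((i.+2%:R)^-1 *: 'X^(i.+2) - (c / i.+1%:R) *: 'X^(i.+1)).

Lemma deriv_chord_poly (R : realType) (theta c : R) (i : nat) z :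
  (chord_poly theta c i)^`().[z] = z ^+ i * ell theta c z.
Proof.
rewrite /chord_poly derivZ derivB !derivZ !derivXn hornerZ hornerD hornerN.
rewrite !hornerZ !hornerMn !hornerXn !succnK.
rewrite -(mulr_natl (z ^+ i.+1) i.+2) -(mulr_natl (z ^+ i) i.+1) /ell exprS.
have n1 : i.+1%:R != 0 :> R by rewrite pnatr_eq0.
have n2 : i.+2%:R != 0 :> R by rewrite pnatr_eq0.
move: n1 n2; move: (sin theta / cos theta) (i.+1%:R : R) (i.+2%:R : R) (z ^+ i).
by move=> k m1 m2 w n1 n2; rewrite mulKf// mulrA divfK//; ring.
Qed.

Section ArcFunctions.
Variables (R : realType) (n : nat) (b : nat -> R) (theta c h : R).
Variables (a d S : R) (x y : R -> R) (G : set (R * R)).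
Variables (phi : R -> R * R) (t1 t2 : R) (p1 p2 : R * R).
Hypotheses (theta_gt0 : 0 < theta) (theta_le_pi : theta <= pi).
Hypothesis ov : oval (potential n b) h a d S x y.
Hypothesis GE : G = range (fun t => (x t, y t)).
Hypothesis arc : orbital_arc (hamiltonian n b) (G `&` Sigma_pos theta c) p1 p2 phi t1 t2.

Let sol : solves (potential n b) (fun t => (phi t).1) (fun t => (phi t).2).
Proof. by case: arc => /is_solution_solves. Qed.

Let t12 : t1 < t2. Proof. by case: arc. Qed.

Let inj s t : t1 < s < t2 -> t1 < t < t2 ->
  (phi s).1 = (phi t).1 -> (phi s).2 = (phi t).2 -> s = t.
Proof.
case: arc => _ _ inj' _ _ ss tt e1 e2; apply: inj'; rewrite ?inE/= ?in_itv//.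
by rewrite [LHS]surjective_pairing [RHS]surjective_pairing e1 e2.
Qed.

Let im_arc t : t1 < t < t2 -> (exists s, (phi t).1 = x s /\ (phi t).2 = y s) /\
  0 < sepline theta c (phi t).1 (phi t).2.
Proof.
case: arc => _ _ _ im _ tt.
have : (phi @` `]t1, t2[) (phi t) by exists t => //=; rewrite in_itv.
by rewrite im GE => -[[s _ E] Sp]; split; [exists s; rewrite -E|exact: Sp].
Qed.

Let arc_onto s : 0 < sepline theta c (x s) (y s) ->
  exists2 t, t1 < t < t2 & (phi t).1 = x s /\ (phi t).2 = y s.
Proof.
case: arc => _ _ _ im _ Ls.
have : (G `&` Sigma_pos theta c) (x s, y s) by split => //; rewrite GE; exists s.
by rewrite -im => -[t /= /[!in_itv]/= tt E]; exists t; rewrite ?E.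
Qed.

Lemma arc_endpoints :
  sepline theta c p1.1 p1.2 = 0 /\ sepline theta c p2.1 p2.2 = 0.
Proof.
case: arc => _ _ _ _ [<- <-]; split.
  exact: (arc_end1 ov sol t12 inj im_arc arc_onto).
exact: (arc_end2 ov sol t12 inj im_arc arc_onto).
Qed.

Lemma arc_energy t : (phi t).2 ^+ 2 = 2 * (h - (potential n b).[(phi t).1]).
Proof.
have [s shift] := arc_shift ov sol t12 im_arc.
by have [-> ->] := shift t; exact: oval_energy ov _.
Qed.

Lemma moment_side_time i : moment t1 t2 phi i = side_time theta c i S x y.
Proof.
apply: (arc_fold ov sol t12 inj im_arc arc_onto (f := fun X _ => X ^+ i)).
move=> X Y cX cY; apply: (lbm_comp (f := fun z : R => z ^+ i)) => //.
by apply: lbm_continuous; exact: exprn_continuous.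
Qed.

Lemma ell_continuous : continuous (ell theta c).
Proof.
move=> z; apply: cvgM; first exact: cvg_cst.
by apply: cvgB; [exact: cvg_id|exact: cvg_cst].
Qed.

(** The form x^i y dx is the sum of x^i (y - ell(x)) dx, which folds to the action,
and of the exact form x^i ell(x) dx. *)
Lemma arcI_action i : arcI phi t1 t2 i 1 =
  action theta c i S x y +
  ((chord_poly theta c i).[p2.1] - (chord_poly theta c i).[p1.1]).
Proof.
have [cu cv] := solves_continuous sol.
pose f (X Y : R) := X ^+ i * (Y - ell theta c X) * Y.
have lpow (X : R -> R) : continuous X -> lbm (fun t => X t ^+ i).
  move=> cX; apply: (lbm_comp (f := fun z : R => z ^+ i)) => //.
  by apply: lbm_continuous; exact: exprn_continuous.
have lell (X : R -> R) : continuous X -> lbm (fun t => ell theta c (X t)).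
  by move=> cX; apply: lbm_comp => //; apply: lbm_continuous; exact: ell_continuous.
have lf (X Y : R -> R) : continuous X -> continuous Y -> lbm (fun t => f (X t) (Y t)).
  move=> cX cY; apply: lbmM; last exact: lbm_continuous.
  apply: lbmM; first exact: lpow.
  by apply: lbmB; [exact: lbm_continuous|exact: lell].
have lfu := lf _ _ cu cv.
pose g t := (phi t).1 ^+ i * ell theta c (phi t).1 * (phi t).2.
have lg : lbm g.
  apply: lbmM; last exact: lbm_continuous.
  by apply: lbmM; [exact: lpow|exact: lell].
have -> : arcI phi t1 t2 i 1 = \int[lebesgue_measure]_(t in `[t1, t2])
    (f (phi t).1 (phi t).2 + g t).
  rewrite /arcI /line_integral (derive1_orbit sol).
  by apply: eq_Rintegral => t _; rewrite /f /g expr1; ring.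
rewrite RintegralD//; try exact: lbm_integrable.
congr (_ + _).
  rewrite (arc_fold ov sol t12 inj im_arc arc_onto lf).
  apply: eq_Rintegral => t _; rewrite /side_height /on_side /f.
  by case: ifP => _; case: ifP => _; ring.
have -> : p1 = phi t1 by case: arc => _ _ _ _ [-> _].
have -> : p2 = phi t2 by case: arc => _ _ _ _ [_ ->].
pose F t := (chord_poly theta c i).[(phi t).1].
have dF (t : R) : is_derive t 1 F (g t).
  apply: (@is_derive_chain _ (horner (chord_poly theta c i)) (fun t => (phi t).1)
    _ _ _ _ (is_derive_poly _ _) (sol t).1).
  by rewrite deriv_chord_poly.
have cF : continuous F by move=> t; exact: is_derive_continuous (dF t).
rewrite /Rintegral (@continuous_FTC2 _ g F)//.
- apply: continuous_subspaceT => t.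
  apply: cvgM; last exact: cv.
  apply: cvgM.
    by apply: (@continuous_comp _ _ _ (fun t => (phi t).1) (fun z => z ^+ i));
      [exact: cu|exact: exprn_continuous].
  by apply: (@continuous_comp _ _ _ (fun t => (phi t).1) (ell theta c));
    [exact: cu|exact: ell_continuous].
- split.
  + by move=> t _; have [] := dF t.
  + by apply: cvg_at_right_filter; exact: cF.
  + by apply: cvg_at_left_filter; exact: cF.
- by move=> t _; rewrite derive1E; have [_ ->] := dF t.
Qed.

End ArcFunctions.

(** * The Picard-Fuchs equations *)

(** For a line that is not vertical, ell (x h) = y h and the chain rule applies.
For a vertical line x is constant and both derivatives vanish. *)
Lemma chord_derive (R : realType) (theta c h0 : R) (i : nat) (x y : R -> R) :
  0 < theta -> theta <= pi ->
  (\forall h \near h0, sepline theta c (x h) (y h) = 0) -> derivable x h0 1 ->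
  is_derive h0 1 (fun h => (chord_poly theta c i).[x h])
    (x h0 ^+ i * y h0 * derive1 x h0).
Proof.
move=> th0 thpi L0 dx.
have dx' : is_derive h0 1 x (derive1 x h0) by apply: DeriveDef => //; rewrite derive1E.
apply: (@is_derive_chain _ (horner (chord_poly theta c i)) x _ _ _ _
  (is_derive_poly _ _) dx').
rewrite deriv_chord_poly; have [c0|c0] := eqVneq (cos theta) 0; last first.
  by rewrite (on_line_ell c0 (nbhs_singleton L0)).
suff -> : derive1 x h0 = 0 by rewrite !mulr0.
have xc : \forall h \near h0, c = x h.
  near=> h; have : sepline theta c (x h) (y h) = 0 by near: h.
  rewrite /sepline c0 (sin_theta_vertical th0 thpi c0) mul0r subr0 mul1r.
  by move=> /subr0_eq.
have := near_eq_is_derive xc (is_derive_cst c h0 1).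
by move=> d; rewrite derive1E; exact: derive_val.
Unshelve. all: end_near. Qed.

Theorem theorem1p2 (R : realType) (n : nat) (b : nat -> R)
    (alpha beta : \bar R) (Gamma : R -> set (R * R)) (theta c : R)
    (x1 y1 x2 y2 : R -> R)
    (phi : R -> R -> R * R) (t1 t2 : R -> R)
    (n_ge2 : (2 <= n)%N) (bn_neq0 : b n != 0)
    (annulus : period_annulus (hamiltonian n b) alpha beta Gamma)
    (theta_gt0 : 0 < theta) (theta_le_pi : theta <= pi)
    (split : forall h, energy_interval alpha beta h ->
       splits theta c (Gamma h))
    (arc : forall h, energy_interval alpha beta h ->
       orbital_arc (hamiltonian n b) (Gamma h `&` Sigma_pos theta c)
         (x1 h, y1 h) (x2 h, y2 h) (phi h) (t1 h) (t2 h))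
    (x1_derivable : forall h, energy_interval alpha beta h -> derivable x1 h 1)
    (x2_derivable : forall h, energy_interval alpha beta h -> derivable x2 h 1) :
  let I (i j : nat) (h : R) := arcI (phi h) (t1 h) (t2 h) i j in
  let Kc (i j : nat) (h : R) := arcK (phi h) (t1 h) (t2 h) i j in
  let Jc (i : nat) (h : R) :=
    x2 h ^+ i * y2 h * derive1 x2 h - x1 h ^+ i * y1 h * derive1 x1 h in
  let X (h : R) : 'cV[R]_(n.-1) := \col_i I i 1%N h in
  let X' (h : R) : 'cV[R]_(n.-1) := \col_i derive1 (I i 1%N) h in
  let J (h : R) : 'cV[R]_(n.-1) := \col_i Jc i h in
  let K (h : R) : 'cV[R]_n := \col_i Kc i 1%N h in
  T4 n b \in unitmx /\
  forall h, energy_interval alpha beta h ->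
    (forall i : 'I_(n.-1), derivable (I i 1%N) h 1) /\
    2 *: ((T1 n b h + T2 n b *m invmx (T4 n b) *m T3 n b h) *m (X' h - J h))
      + 2 *: (T2 n b *m invmx (T4 n b) *m K h) = X h.
Proof.
move=> I Kc Jc X X' J K.
split; first by apply: T4_unit => //; exact: ltnW.
move=> h0 h0_in.
have nearE := near_energy_interval h0_in.
have ovals h : energy_interval alpha beta h -> exists a d S x y,
    oval (potential n b) h a d S x y /\ Gamma h = range (fun t => (x t, y t)).
  by move=> hin; have [po lvl _] := annulus _ hin; exact: oval_of_orbit.
have [a0 [d0 [S0 [x0 [y0 [ov0 G0]]]]]] := ovals h0 h0_in.
have ends h : energy_interval alpha beta h ->
    sepline theta c (x1 h) (y1 h) = 0 /\ sepline theta c (x2 h) (y2 h) = 0.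
  move=> hin; have [a [d [S [x [y [ov GE]]]]]] := ovals h hin.
  exact: (arc_endpoints ov GE (arc _ hin)).
pose A i := moment (t1 h0) (t2 h0) (phi h0) i.
have dI i : is_derive h0 1 (I i 1) (A i + Jc i h0).
  pose Q := chord_poly theta c i.
  have dQ1 : is_derive h0 1 (fun h => Q.[x1 h]) (x1 h0 ^+ i * y1 h0 * derive1 x1 h0).
    apply: chord_derive => //; last exact: x1_derivable.
    by apply: filterS nearE => h /ends[].
  have dQ2 : is_derive h0 1 (fun h => Q.[x2 h]) (x2 h0 ^+ i * y2 h0 * derive1 x2 h0).
    apply: chord_derive => //; last exact: x2_derivable.
    by apply: filterS nearE => h /ends[].
  have dQ : is_derive h0 1 (fun h => Q.[x2 h] - Q.[x1 h]) (Jc i h0).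
    exact: is_deriveB.
  pose N h := I i 1%N h - (Q.[x2 h] - Q.[x1 h]).
  have dN : is_derive h0 1 N (A i).
    rewrite /A (moment_side_time ov0 G0 (arc _ h0_in)).
    apply: (action_derive theta_gt0 theta_le_pi ov0) => e e0.
    have [_ _ hc] := annulus _ h0_in.
    have close := oval_ends_continuous hc ov0 G0 e0.
    near=> h.
    have hin : energy_interval alpha beta h by near: h.
    have [a [d [S [x [y [ov GE]]]]]] := ovals h hin.
    have cl : forall a d S x y, oval (potential n b) h a d S x y ->
        Gamma h = range (fun t => (x t, y t)) -> `|a - a0| < e /\ `|d - d0| < e.
      by near: h.
    have [ea ed] := cl _ _ _ _ _ ov GE.
    exists a, d, S, x, y; split => //.
    by rewrite /N /I (arcI_action ov GE (arc _ hin))/= addrK.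
  have -> : I i 1%N = (fun h => N h + (Q.[x2 h] - Q.[x1 h])).
    by apply/funext => h; rewrite /N subrK.
  exact: is_deriveD.
split; first by move=> i; have [] := dI i.
have sol : solves (potential n b) (fun t => (phi h0 t).1) (fun t => (phi h0 t).2).
  by have [/is_solution_solves] := arc _ h0_in.
have en := arc_energy ov0 G0 (arc _ h0_in).
have -> : X' h0 - J h0 = \col_i A i.
  apply/matrixP => i j; rewrite !mxE derive1E.
  by rewrite (@derive_val _ _ _ _ _ _ _ (dI i)) addrK.
apply: (@picard_fuchs_algebra R n b A h0 n_ge2 (fun i => I i 1%N h0)
  (fun i => Kc i 1%N h0)) => //.
- by move=> i; exact: arcI_moments.
- by move=> i; exact: arcK_moments.
Unshelve. all: end_near. Qed.
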